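(* Let $E, F \subseteq \mathbb{R}$ be (dyadic) wavelet sets and let $\sigma_E^F$ be the interpolation map of the ordered pair $(E,F)$. The following two statements are equivalent: (i) $(E,F)$ is an interpolation pair, i.e. $\sigma_E^F\circ\sigma_E^F = \mathrm{id}_{\mathbb{R}}$ (modulo null sets); (ii) $\sigma_E^F(E\cup F)\subseteq E\cup F$ (modulo null sets).
   Context: All sets are Lebesgue measurable, $\mu$ is Lebesgue measure, and all equalities, inclusions and bijections between sets, and equalities between maps, are understood modulo null sets (almost everywhere). A dyadic orthonormal wavelet is a function $\psi\in L^2(\mathbb{R})$ such that $\{2^{n/2}\psi(2^n\cdot - l) : n,l\in\mathbb{Z}\}$ is an orthonormal basis of $L^2(\mathbb{R})$. With the Fourier transform $(\mathcal{F}f)(s)=\frac{1}{\sqrt{2\pi}}\int_{\mathbb{R}}e^{-ist}f(t)\,dt$, a measurable set $E\subseteq\mathbb{R}$ is a wavelet set if $\mathcal{F}^{-1}\big(\frac{1}{\sqrt{\mu(E)}}\chi_E\big)$ is a dyadic orthonormal wavelet. A known characterization: $E$ is a wavelet set if and only if both $\{E+2n\pi\}_{n\in\mathbb{Z}}$ and $\{2^nE\}_{n\in\mathbb{Z}}$ are measurable partitions of $\mathbb{R}$. (A sequence of measurable sets $\{E_n\}$ is a measurable partition of $E$ if $E\,\Delta\,\bigcup_n E_n$ is null and $E_n\cap E_m$ is null for $n\neq m$.) Interpolation map: for wavelet sets $E,F$, for almost every $s\in E$ there is a unique $n\in\mathbb{Z}$ with $s+2n\pi\in F$, and one sets $\sigma_E^F(s)=s+2n\pi$;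 this is a bijection $E\to F$ modulo null sets. It is extended to a measurable bijection (modulo null sets) of $\mathbb{R}$ by $\sigma_E^F(0)=0$ and $\sigma_E^F(s)=2^n\sigma_E^F(2^{-n}s)$ for $s\in 2^nE$, $n\in\mathbb{Z}$. *)

(* Defs.v *)
(* MathComp / MathComp-Analysis *)
From HB Require Import structures.
From mathcomp Require Import all_boot all_order all_algebra.
From mathcomp Require Import all_classical all_reals all_analysis.
From mathcomp Require Import complex.

Set Implicit Arguments.
Unset Strict Implicit.
Unset Printing Implicit Defensive.
Import Order.TTheory GRing.Theory Num.Theory.
Import numFieldNormedType.Exports.

Local Open Scope classical_set_scope.
Local Open Scope ring_scope.
Local Open Scope complex_scope.

(* The library integrates real-valued functions only. *)
Definition cintegral d (T : measurableType d) (R : realType)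
    (mu : {measure set T -> \bar R}) (f : T -> R[i]) : R[i] :=
  (\int[mu]_x complex.Re (f x)) +i* (\int[mu]_x complex.Im (f x)).

(* Elements of L^2(R) are given by Borel representatives; every class of
   Lebesgue measurable functions modulo null sets has one. *)
Definition cL2 (R : realType) (f : R -> R[i]) : Prop :=
  ((fun t => complex.Re (f t)) \in Lfun (@lebesgue_measure R) 2%:E) /\
  ((fun t => complex.Im (f t)) \in Lfun (@lebesgue_measure R) 2%:E).

Definition cL2_inner (R : realType) (f g : R -> R[i]) : R[i] :=
  cintegral (@lebesgue_measure R) (fun t => f t * conjc (g t)).

Definition cL2_sqnorm (R : realType) (f : R -> R[i]) : \bar R :=
  (\int[@lebesgue_measure R]_t (Normc.normc (f t) ^+ 2)%:E)%E.

(* The third condition is the density of the linear span of e in L^2(R). *)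
Definition orthonormal_basis (R : realType) (I : eqType)
    (e : I -> R -> R[i]) : Prop :=
  [/\ forall i, cL2 (e i),
      forall i j, cL2_inner (e i) (e j) = (i == j)%:R
    & forall f, cL2 f -> forall eps : R, 0 < eps ->
        exists (s : seq I) (c : I -> R[i]),
          (cL2_sqnorm (fun t => f t - \sum_(i <- s) c i * e i t)%R < eps%:E)%E].

Definition wavelet_system (R : realType) (psi : R -> R[i])
    (p : int * int) (t : R) : R[i] :=
  (2 `^ (p.1%:~R / 2))%:C * psi (2 ^ p.1 * t - p.2%:~R).

Definition dyadic_orthonormal_wavelet (R : realType) (psi : R -> R[i]) : Prop :=
  cL2 psi /\ orthonormal_basis (wavelet_system psi).

Definition cexpi (R : realType) (x : R) : R[i] := cos x +i* sin x.

(* The inverse Fourier transform on L^1 /\ L^2, where the unitary inverse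
   transform of L^2(R) is given by the integral. The completed measure is used
   because g need only be Lebesgue (not Borel) measurable. *)
Definition inverse_fourier (R : realType) (g : R -> R[i]) (t : R) : R[i] :=
  ((Num.sqrt (2 * pi))^-1)%:C *
  cintegral (@completed_lebesgue_measure R) (fun s => cexpi (s * t) * g s).

(* The Caratheodory sigma-algebra of the outer measure of interval lengths. *)
Definition lebesgue_measurable (R : realType) (A : set R) : Prop :=
  ((wlength idfun)^*%mu).-cara.-measurable A.

(* 0 < mu(E) < +oo is what gives a meaning to 1 / sqrt (mu(E));
   it also puts chi_E in L^1 /\ L^2. *)
Definition wavelet_set (R : realType) (E : set R) : Prop :=
  [/\ lebesgue_measurable E,
      (0 < completed_lebesgue_measure E < +oo)%E
    & dyadic_orthonormal_wavelet (inverse_fourier (fun s =>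
        ((Num.sqrt (fine (completed_lebesgue_measure E)))^-1 * \1_E s)%:C))].

(* For wavelet sets E and F, almost every s in E has exactly one translate by
   a multiple of 2 pi in F; on the exceptional null set the value is an
   arbitrary such translate, or s if there is none. *)
Definition interpolation_base (R : realType) (F : set R) (s : R) : R :=
  xget s [set t | F t /\ exists n : int, t = s + 2 * n%:~R * pi].

(* 2^-n s \in E says that s \in 2^n E; for almost every s there is exactly
   one such n. On the exceptional null set, xget returns an arbitrary such n,
   or 0 if there is none. *)
Definition interpolation_map (R : realType) (E F : set R) (s : R) : R :=
  if s == 0 then 0 else
  let n : int := xget 0 [set n : int | E (2 ^ (- n) * s)] in
  2 ^ n * interpolation_base F (2 ^ (- n) * s).

Definition interpolation_pair (R : realType) (E F : set R) : Prop :=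
  {ae @lebesgue_measure R, forall s,
    interpolation_map E F (interpolation_map E F s) = s}.

Definition ae_subset (R : realType) (A B : set R) : Prop :=
  (@lebesgue_measure R).-negligible (A `\` B).

(* Main.v *)
(* A wavelet set E is first shown to tile the line, up to null sets, under
   translations by 2 k pi and under dilations by 2 ^ n.  Plancherel's formula is
   proved for step functions from int (1 - cos (a t)) / t ^ 2 dt = kappa |a| (the
   value of kappa is irrelevant) and extended by density; it turns the
   orthonormality and the completeness of the wavelet system into statements on
   the functions e^(i l s / 2 ^ n) on 2 ^ n E.  Orthogonality of the dilates says
   that the sets 2 ^ n E are disjoint.  Completeness, tested against the indicator
   of a set that misses all of them, gives that they cover, and tested against
   1_A - 1_(A + 2 k pi) with A and A + 2 k pi in E, that the translates of E are
   disjoint.  Finally the Fourier coefficients of 1_E vanish at all l <> 0, so the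
   2 pi periodization of 1_E is constant, hence the translates cover.

   Off an invariant null set, sigma = sigma_E^F is thus an injective map commuting
   with dilations.  Assume that sigma preserves E \/ F, and let t = sigma s with
   s in E, so that t is in F and in 2 ^ n E for some n.  For n > 0, sigma t lies in
   2 ^ n F, hence not in F, hence in E, and it differs from s by a multiple of
   2 pi, so it is s.  For n < 0 the same argument applies to 2 ^ (- n) sigma t in
   F and 2 ^ (- n) E, and injectivity brings the conclusion back to s. *)
Require Import Defs.
From mathcomp Require Import all_boot all_order all_algebra.
From mathcomp Require Import all_classical all_reals all_analysis.
From mathcomp Require Import measurable_realfun complex ring lra.
Set Implicit Arguments.
Unset Strict Implicit.
Unset Printing Implicit Defensive.
Import Order.TTheory GRing.Theory Num.Theory.
Import numFieldNormedType.Exports.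
Local Open Scope classical_set_scope.
Local Open Scope ring_scope.

(** [wavelet_set] speaks of an orthonormal basis only, so four almost-everywhere facts (dilates and
    translates cover and are disjoint) have to be extracted from it; they are collected in
    [partitions_off], and no harmonic analysis occurs afterwards. Transforms are split into cosine
    and sine integrals, so that every estimate concerns real integrals. As [E] is merely Lebesgue
    measurable, the analysis is done on a Borel set [B] that differs from [E] by a null set. What
    matters about kappa is that it is nonzero, which is read off from the norm 1 of the wavelet. The
    algebraic half composes dilations, translations and sigma, so its exceptional null set must be
    stable under [s -> 2 s] and [s -> s + 2 pi]. The group they generate contains translations by
    dyadic multiples of [2 pi]; countably many affine preimages with rational coefficients absorb it
    and keep the set null. Outside this hull every statement holds at every point. The sign of [n]
    matters there because [2 ^ n * 2 k pi] is always a multiple of [2 pi] only for [n >= 0]. *)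

Lemma measurable_affine (R : realType) (a b : R) :
  measurable_fun [set: R] (fun x : R => a * x + b).
Proof. by apply: measurable_funD => //; exact: measurable_funM. Qed.

(** The pushforward under the affine map, scaled by [|a|], gives half-open intervals their length,
    and this determines the measure. For [a < 0] the preimage of such an interval is closed on the
    other side, which does not change its length. *)
Lemma lebesgue_measure_affine (R : realType) (a b : R) (A : set R) : a != 0 ->
  measurable A ->
  (`|a|%:E * lebesgue_measure ((fun x => a * x + b)%R @^-1` A) =
   lebesgue_measure A)%E.
Proof.
move=> a0 mA.
pose phi : measurableTypeR R -> measurableTypeR R := fun x : R => a * x + b.
have mphi : measurable_fun setT phi by exact: measurable_affine.
pose nu0 := mscale (NngNum (normr_ge0 a)) (pushforward (@lebesgue_measure R) phi).
pose nu := nu0 mphi.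
suff -> : lebesgue_measure A = nu A by [].
apply: lebesgue_measure_unique => // _ [[x y] _ <-] /=.
rewrite /nu /nu0 /mscale/= /pushforward.
have [xy|yx] := ltP x y; last first.
  by rewrite set_itv_ge ?preimage_set0 ?measure0 ?mule0// bnd_simp -leNgt.
have [ap|an] : 0 < a \/ a < 0.
  by move: a0; rewrite neq_lt => /orP[]; [right|left].
- have -> : phi @^-1` `]x, y] = `](x - b) / a, (y - b) / a]%classic.
    apply/seteqP; split => z /=; rewrite !in_itv/= /phi.
      by move=> /andP[h1 h2]; rewrite ltr_pdivrMr// ler_pdivlMr//; apply/andP; split; nra.
    by rewrite ltr_pdivrMr// ler_pdivlMr// => /andP[h1 h2]; apply/andP; split; nra.
  rewrite !lebesgue_measure_itv/= !lte_fin xy ltr_pM2r ?invr_gt0//.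
  rewrite ltrD2r xy -!EFinD -EFinM gtr0_norm//; congr (_%:E); field.
  by rewrite gt_eqF.
- have -> : phi @^-1` `]x, y] = `[(y - b) / a, (x - b) / a[%classic.
    apply/seteqP; split => z /=; rewrite !in_itv/= /phi.
      by move=> /andP[h1 h2]; rewrite ltr_ndivlMr// ler_ndivrMr//; apply/andP; split; nra.
    by rewrite ltr_ndivlMr// ler_ndivrMr// => /andP[h1 h2]; apply/andP; split; nra.
  rewrite !lebesgue_measure_itv/= !lte_fin xy ltr_nM2r ?invr_lt0//.
  rewrite ltrD2r xy -!EFinD -EFinM ltr0_norm//; congr (_%:E); field.
  by rewrite lt_eqF.
Qed.

Lemma ge0_integral_affine (R : realType) (a b : R) (f : R -> \bar R) : a != 0 ->
  measurable_fun [set: R] f -> (forall x, 0 <= f x)%E ->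
  (`|a|%:E * \int[lebesgue_measure]_x f (a * x + b)%R =
   \int[lebesgue_measure]_x f x)%E.
Proof.
move=> a0 mf f0.
pose phi : measurableTypeR R -> measurableTypeR R := fun x : R => a * x + b.
have mphi : measurable_fun setT phi by exact: measurable_affine.
pose nu0 := mscale (NngNum (normr_ge0 a)) (pushforward (@lebesgue_measure R) phi).
pose nu := nu0 mphi.
transitivity (\int[nu]_x f x)%E; last first.
  by apply: eq_measure_integral => A mA _; exact: lebesgue_measure_affine.
rewrite /nu /nu0 ge0_integral_mscale//=; congr (_ * _)%E.
by rewrite ge0_integral_pushforward.
Qed.

(** * Integrable real functions on the line *)

Definition L1 (R : realType) (f : R -> R) : Prop :=
  (@lebesgue_measure R).-integrable setT (EFin \o f).

Local Notation mint f := (\int[lebesgue_measure]_x f x)%R.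

Section L1_theory.
Context {R : realType}.
Implicit Types f g h : R -> R.

Lemma L1_measurable f : L1 f -> measurable_fun setT f.
Proof. by move=> /measurable_int /measurable_EFinP. Qed.

Lemma L1_eq f g : L1 f -> f =1 g -> L1 g.
Proof. by move=> + /funext <-. Qed.

Lemma L1_le f g : measurable_fun setT f -> (forall x, `|f x| <= g x) ->
  L1 g -> L1 f.
Proof.
move=> mf fg ig; apply: (le_integrable measurableT _ _ ig).
  exact/measurable_EFinP.
by move=> x _ /=; rewrite lee_fin (le_trans (fg x))// ler_norm.
Qed.

Lemma L1_0 : L1 (fun _ : R => 0).
Proof. exact: integrable0. Qed.

Lemma L1D f g : L1 f -> L1 g -> L1 (fun x => f x + g x).
Proof. by move=> fi gi; exact: (integrableD measurableT fi gi). Qed.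

Lemma L1B f g : L1 f -> L1 g -> L1 (fun x => f x - g x).
Proof. by move=> fi gi; exact: (integrableB measurableT fi gi). Qed.

Lemma L1Z (k : R) f : L1 f -> L1 (fun x => k * f x).
Proof. by move=> fi; exact: (integrableZl measurableT k fi). Qed.

Lemma L1N f : L1 f -> L1 (fun x => - f x).
Proof. by move=> fi; apply: L1_eq (L1Z (-1) fi) _ => x; rewrite mulN1r. Qed.

Lemma L1_norm f : L1 f -> L1 (fun x => `|f x|).
Proof. by move=> ?; exact: integrable_norm. Qed.

Lemma L1_bounded_mul (M : R) h f : measurable_fun setT h ->
  (forall x, `|h x| <= M) -> L1 f -> L1 (fun x => f x * h x).
Proof.
move=> mh hM fi; apply: (@L1_le _ (fun x => M * `|f x|)).
- by apply: measurable_funM => //; exact: L1_measurable.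
- by move=> x; rewrite normrM mulrC ler_wpM2r.
- exact/L1Z/L1_norm.
Qed.

Lemma mintD f g : L1 f -> L1 g ->
  mint (fun x => f x + g x) = mint f + mint g.
Proof. by move=> ? ?; rewrite RintegralD. Qed.

Lemma mintB f g : L1 f -> L1 g ->
  mint (fun x => f x - g x) = mint f - mint g.
Proof. by move=> ? ?; rewrite RintegralB. Qed.

Lemma mintZ (k : R) f : L1 f -> mint (fun x => k * f x) = k * mint f.
Proof. by move=> ?; rewrite RintegralZl. Qed.

Lemma mintN f : L1 f -> mint (fun x => - f x) = - mint f.
Proof.
by move=> fi; rewrite -mulN1r -mintZ//; apply: eq_Rintegral => x _; rewrite mulN1r.
Qed.

Lemma mint_ge0 f : (forall x, 0 <= f x) -> 0 <= mint f.
Proof. by move=> f0; apply: Rintegral_ge0. Qed.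

Lemma mint_le f g : L1 f -> L1 g -> (forall x, f x <= g x) -> mint f <= mint g.
Proof. by move=> ? ? ?; apply: le_Rintegral. Qed.

Lemma mint_norm f : L1 f -> `|mint f| <= mint (fun x => `|f x|).
Proof. by move=> ?; apply: le_normr_Rintegral. Qed.

Lemma mint_eq f g : f =1 g -> mint f = mint g.
Proof. by move=> /funext ->. Qed.

Lemma EFin_mint f : L1 f -> ((mint f)%:E = \int[lebesgue_measure]_x (f x)%:E)%E.
Proof. by move=> fi; rewrite /Rintegral fineK//; exact: integrable_fin_num. Qed.

Lemma ge0_L1 f : measurable_fun setT f -> (forall x, 0 <= f x) ->
  (\int[lebesgue_measure]_x (f x)%:E < +oo)%E -> L1 f.
Proof.
move=> mf f0 fi; apply/integrableP; split; first exact/measurable_EFinP.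
by under eq_integral do rewrite /= ger0_norm//.
Qed.

Lemma L1_affine (a b : R) f : a != 0 -> L1 f -> L1 (fun x => f (a * x + b)).
Proof.
move=> a0 fi; have mf := L1_measurable fi; apply/integrableP; split.
  apply/measurable_EFinP; apply: (measurableT_comp mf); exact: measurable_affine.
have := ge0_integral_affine b a0 (f := fun x => (`|f x|)%:E).
have mnf : measurable_fun setT (fun x : R => (`|f x|)%:E).
  by do 2 apply: measurableT_comp => //.
move=> /(_ mnf (fun _ => normr_ge0 _)) e.
have : (\int[lebesgue_measure]_x (`|f x|)%:E < +oo)%E.
  by move/integrableP : fi => [].
rewrite -e /= => h; rewrite ltey; apply/eqP => h1; move: h.
by rewrite h1 gt0_muley ?ltxx// lte_fin normr_gt0.
Qed.

Lemma mint_affine (a b : R) f : a != 0 -> L1 f ->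
  `|a| * mint (fun x => f (a * x + b)) = mint f.
Proof.
move=> a0 fi; have mf := L1_measurable fi.
wlog f0 : f fi mf / forall x, 0 <= f x.
  (* Reduction to nonnegative functions: [f] is the difference of [|f| + f] and [|f|]. *)
  move=> H; pose p x := (`|f x| + f x); pose q x := (`|f x|).
  have ip : L1 p by apply: L1D => //; exact: L1_norm.
  have iq : L1 q by exact: L1_norm.
  have fE x : f x = p x - q x by rewrite /p /q addrAC subrr add0r.
  have p0 x : 0 <= p x by rewrite /p -[X in _ + X]opprK subr_ge0 -normrN ler_norm.
  have e1 := H p ip (L1_measurable ip) p0.
  have e2 := H q iq (L1_measurable iq) (fun x => normr_ge0 _).
  rewrite (mint_eq fE) mintB// -e1 -e2 -mulrBr.
  rewrite -mintB; [|exact: L1_affine|exact: L1_affine].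
  by congr (_ * _); apply: mint_eq => x; rewrite -fE.
apply: EFin_inj; rewrite EFinM !EFin_mint//; last exact: L1_affine.
by apply: (ge0_integral_affine b a0 (f := EFin \o f)) => //; exact/measurable_EFinP.
Qed.

End L1_theory.

(** * The kernel [(1 - cos (a t)) / t ^ 2] and its integral *)

Lemma normr_sin_le (R : realType) (x : R) : `|sin x| <= `|x|.
Proof.
wlog x0 : x / 0 <= x.
  move=> H; have [/H//|x0] := leP 0 x.
  by rewrite -normrN -sinN -[leRHS]normrN H// oppr_ge0 ltW.
move: x0; rewrite le_eqVlt => /predU1P[<-|x0]; first by rewrite sin0.
have [|c _] := @MVT _ (@sin R) (@cos R) 0 x x0.
  by apply: continuous_subspaceT => y; exact: continuous_sin.
rewrite sin0 !subr0 => ->; rewrite normrM ler_piMl//; exact: cos_max.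
Qed.

Lemma one_sub_cos_le (R : realType) (x : R) : 1 - cos x <= x ^+ 2 / 2.
Proof.
have -> : 1 - cos x = 2 * sin (x / 2) ^+ 2.
  have {1}-> : x = (x / 2) *+ 2 by rewrite mulr2n -splitr.
  by rewrite cos_mulr2n cos2sin2 mulr2n; ring.
have := normr_sin_le (x / 2); rewrite -ler_sqr ?nnegrE// !real_normK ?num_real// => h.
apply: le_trans (_ : 2 * (x / 2) ^+ 2 <= _); first by rewrite ler_pM2l.
by rewrite expr_div_n; lra.
Qed.

(* Rocq's division makes this kernel vanish at 0. *)
Definition cosker (R : realType) (a t : R) : R := (1 - cos (a * t)) / t ^+ 2.

Lemma measurable_cosM (R : realType) (a : R) :
  measurable_fun setT (fun t : R => cos (a * t)).
Proof.
apply: continuous_measurable_fun => t; apply: continuous_comp.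
  exact: mulrl_continuous.
exact: continuous_cos.
Qed.

Lemma measurable_sinM (R : realType) (a : R) :
  measurable_fun setT (fun t : R => sin (a * t)).
Proof.
apply: continuous_measurable_fun => t; apply: continuous_comp.
  exact: mulrl_continuous.
exact: continuous_sin.
Qed.

Lemma measurable_invr (R : realType) : measurable_fun setT (@GRing.inv R).
Proof.
have -> : @GRing.inv R = fun x => if x == 0 then 0 else x^-1.
  by apply/funext => x; case: eqP => // ->; rewrite invr0.
have m0 : measurable_fun setT (fun x : R => x == 0).
  by apply: measurable_fun_eqr => //.
apply: measurable_fun_if => //=. rewrite setTI; apply: open_continuous_measurable_fun.
  rewrite (_ : _ @^-1` _ = ~` [set 0]); last first.
    apply/seteqP; split => x /=; first by move=> h x0; rewrite x0 eqxx in h.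
    by move=> /eqP/negbTE.
  exact/closed_openC.
by move=> x; rewrite inE/= => /eqP/eqP x0; exact: inv_continuous.
Qed.

Lemma measurable_cosker (R : realType) (a : R) : measurable_fun setT (cosker a).
Proof.
apply: measurable_funM.
  by apply: measurable_funB => //; exact: measurable_cosM.
by apply: (measurableT_comp (@measurable_invr R)); exact: measurable_funX.
Qed.

Lemma cosker_ge0 (R : realType) (a t : R) : 0 <= cosker a t.
Proof. by rewrite /cosker mulr_ge0 ?invr_ge0 ?sqr_ge0// subr_ge0 cos_le1. Qed.

Lemma L1_oneDsqrV (R : realType) : L1 (fun t : R => (oneDsqr t)^-1).
Proof.
have c : continuous (fun t : R => (oneDsqr t)^-1) by exact: continuous_oneDsqrV.
have p (t : R) : 0 <= (oneDsqr t)^-1.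
  by rewrite invr_ge0 (le_trans _ (oneDsqr_ge1 t)).
apply: ge0_L1 => //; first exact: continuous_measurable_fun.
rewrite ge0_symfun_integralT//; last first.
  by move=> t; rewrite /= /oneDsqr sqrrN.
have := @integral0y_oneDsqr R; rewrite set_itvcy => ->.
by rewrite -EFinM ltry.
Qed.

(** The majorant [4 / (1 + t ^ 2)] serves both regimes: [1 - cos t <= t ^ 2 / 2] when [t ^ 2 <= 1],
    and [1 - cos t <= 2] beyond. *)
Lemma L1_cosker1 (R : realType) : L1 (@cosker R 1).
Proof.
apply: L1_le (L1Z 4 (L1_oneDsqrV R)); first exact: measurable_cosker.
move=> t; rewrite ger0_norm ?cosker_ge0// /cosker mul1r /oneDsqr.
have [->|t0] := eqVneq t 0.
  by rewrite cos0 subrr mul0r mulr_ge0// invr_ge0 ler_wpDr// sqr_ge0.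
have t2 : 0 < t ^+ 2 by rewrite exprn_even_gt0.
rewrite ler_pdivrMr// mulrAC ler_pdivlMr; last by rewrite ltr_wpDr// ltW.
have h1 := one_sub_cos_le t; have h2 := cos_geN1 t; have h3 := cos_le1 t.
have [t1|t1] := leP (t ^+ 2) 1; nra.
Qed.

(** The classical value is [pi]. It is kept as an unknown constant, shown to be nonzero in
    [wavelet_const_neq0]. *)
Definition coskappa (R : realType) : R := \int[lebesgue_measure]_t cosker 1 t.

Lemma coskerE (R : realType) (a t : R) : a != 0 ->
  cosker a t = a ^+ 2 * cosker 1 (a * t + 0).
Proof.
move=> a0; rewrite /cosker addr0 mul1r.
have [->|t0] := eqVneq t 0; first by rewrite mulr0 cos0 subrr !mul0r mulr0.
by field; rewrite t0.
Qed.

Lemma L1_cosker (R : realType) (a : R) : L1 (cosker a).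
Proof.
have [->|a0] := eqVneq a 0.
  by apply: L1_eq (@L1_0 R) _ => t; rewrite /cosker mul0r cos0 subrr mul0r.
have := L1Z (a ^+ 2) (L1_affine 0 a0 (L1_cosker1 R)).
by move/L1_eq; apply => t; rewrite -coskerE.
Qed.

(** Homogeneity: the kernel scales by [a ^ 2], and the change of variable takes back a factor
    [|a|]. *)
Lemma mint_cosker (R : realType) (a : R) :
  \int[lebesgue_measure]_t cosker a t = coskappa R * `|a|.
Proof.
have [->|a0] := eqVneq a 0.
  rewrite normr0 mulr0 (mint_eq (_ : _ =1 fun=> 0)); last first.
    by move=> t; rewrite /cosker mul0r cos0 subrr mul0r.
  by rewrite Rintegral_cst// mul0r.
rewrite (mint_eq (fun t => coskerE t a0)) mintZ; last exact/L1_affine/L1_cosker1.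
rewrite /coskappa -(mint_affine 0 a0 (L1_cosker1 R)).
by rewrite -[a ^+ 2]real_normK ?num_real// expr2; ring.
Qed.

(** [costr u] and [sintr u] are the real and imaginary parts of the integral of [u s * exp (i t s)],
    the inverse Fourier transform of a real [u] without its normalization. *)
Definition costr (R : realType) (u : R -> R) (t : R) : R :=
  \int[lebesgue_measure]_s (u s * cos (t * s)).
Definition sintr (R : realType) (u : R -> R) (t : R) : R :=
  \int[lebesgue_measure]_s (u s * sin (t * s)).

(** * Cosine and sine transforms, and their values on intervals *)

Section transforms.
Context {R : realType}.
Implicit Types u v : R -> R.

Lemma L1_costr u t : L1 u -> L1 (fun s => u s * cos (t * s)).
Proof.
move=> ui; apply: L1_bounded_mul ui; first exact: measurable_cosM.
by move=> x; exact: cos_max.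
Qed.

Lemma L1_sintr u t : L1 u -> L1 (fun s => u s * sin (t * s)).
Proof.
move=> ui; apply: L1_bounded_mul ui; first exact: measurable_sinM.
by move=> x; exact: sin_max.
Qed.

Lemma costrD u v t : L1 u -> L1 v ->
  costr (fun s => u s + v s) t = costr u t + costr v t.
Proof.
move=> ui vi; rewrite /costr -mintD; [|exact: L1_costr|exact: L1_costr].
by apply: mint_eq => s; rewrite mulrDl.
Qed.

Lemma sintrD u v t : L1 u -> L1 v ->
  sintr (fun s => u s + v s) t = sintr u t + sintr v t.
Proof.
move=> ui vi; rewrite /sintr -mintD; [|exact: L1_sintr|exact: L1_sintr].
by apply: mint_eq => s; rewrite mulrDl.
Qed.

Lemma costrZ k u t : L1 u -> costr (fun s => k * u s) t = k * costr u t.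
Proof.
move=> ui; rewrite /costr -mintZ; last exact: L1_costr.
by apply: mint_eq => s; rewrite mulrA.
Qed.

Lemma sintrZ k u t : L1 u -> sintr (fun s => k * u s) t = k * sintr u t.
Proof.
move=> ui; rewrite /sintr -mintZ; last exact: L1_sintr.
by apply: mint_eq => s; rewrite mulrA.
Qed.

Lemma costr0 t : costr (fun _ : R => 0) t = 0.
Proof.
rewrite /costr (mint_eq (_ : _ =1 fun=> 0)); first by rewrite Rintegral_cst// mul0r.
by move=> s; rewrite mul0r.
Qed.

Lemma sintr0 t : sintr (fun _ : R => 0) t = 0.
Proof.
rewrite /sintr (mint_eq (_ : _ =1 fun=> 0)); first by rewrite Rintegral_cst// mul0r.
by move=> s; rewrite mul0r.
Qed.

Lemma normr_costr u t : L1 u ->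
  `|costr u t| <= \int[lebesgue_measure]_s `|u s|.
Proof.
move=> ui; apply: le_trans (mint_norm (L1_costr t ui)) _.
apply: mint_le => [||s]; [exact/L1_norm/L1_costr|exact: L1_norm|].
by rewrite normrM ler_piMr//; exact: cos_max.
Qed.

Lemma normr_sintr u t : L1 u ->
  `|sintr u t| <= \int[lebesgue_measure]_s `|u s|.
Proof.
move=> ui; apply: le_trans (mint_norm (L1_sintr t ui)) _.
apply: mint_le => [||s]; [exact/L1_norm/L1_sintr|exact: L1_norm|].
by rewrite normrM ler_piMr//; exact: sin_max.
Qed.

Lemma mint_indic (A : set R) (g : R -> R) :
  \int[lebesgue_measure]_s (\1_A s * g s) = \int[lebesgue_measure]_(s in A) g s.
Proof.
rewrite [RHS]Rintegral_mkcond; apply: mint_eq => s.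
by rewrite patchE indicE; case: (s \in A); rewrite ?mul1r ?mul0r.
Qed.

Lemma L1_itv (a b : R) : L1 (\1_`]a, b]%classic : R -> R).
Proof. exact: integrable_indic_itv. Qed.

Lemma mint_itv_FTC (a b : R) (f F : R -> R) : a < b -> continuous f ->
  (forall x, is_derive (x : R^o) (1 : R^o) (F : R^o -> R^o) (f x)) ->
  \int[lebesgue_measure]_s (\1_(`]a, b]%classic) s * f s) = F b - F a.
Proof.
move=> ab cf dF; rewrite mint_indic.
have fi : (@lebesgue_measure R).-integrable `[a, b] (EFin \o f).
  apply: continuous_compact_integrable; first exact: segment_compact.
  exact: continuous_subspaceT.
rewrite Rintegral_itv_obnd_cbnd; last first.
  by apply: integrableS fi => //; exact: subset_itv_oc_cc.
have cF : continuous F.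
  by move=> x; apply/differentiable_continuous/derivable1_diffP; have [] := dF x.
rewrite /Rintegral (@continuous_FTC2 _ f F a b) //.
- exact: continuous_subspaceT.
- split => [x _||]; first by have [] := dF x.
    by apply: cvg_at_right_filter; exact: cF.
  by apply: cvg_at_left_filter; exact: cF.
- by move=> x _; rewrite derive1E; apply: derive_val.
Qed.

Lemma is_derive_mul (t s : R) :
  is_derive (s : R^o) (1 : R^o) (fun x : R^o => t * x) t.
Proof.
have -> : (fun x : R^o => t * x) = t \*: (id : R^o -> R^o) by [].
by apply: is_derive_eq; rewrite /GRing.scale/= mulr1.
Qed.

Lemma is_derive_scale (c s d : R) (f : R -> R) : is_derive (s : R^o) (1 : R^o) f d ->
  is_derive (s : R^o) (1 : R^o) (fun x : R^o => c * f x) (c * d).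
Proof. exact: is_deriveZ. Qed.

Lemma costr_itv (a b t : R) : a < b -> t != 0 ->
  costr (\1_`]a, b]%classic) t = (sin (t * b) - sin (t * a)) / t.
Proof.
move=> ab t0.
have cf : continuous (fun s => cos (t * s)).
  by move=> s; apply: continuous_comp; [exact: mulrl_continuous|exact: continuous_cos].
have dF s : is_derive (s : R^o) (1 : R^o) (fun s => t^-1 * sin (t * s)) (cos (t * s)).
  have := is_derive_scale t^-1 (is_derive1_comp (is_derive_sin (t * s)) (is_derive_mul t s)).
  by rewrite mulrA mulrAC mulVf// mul1r.
by rewrite /costr (mint_itv_FTC ab cf dF) -mulrBr mulrC.
Qed.

Lemma sintr_itv (a b t : R) : a < b -> t != 0 ->
  sintr (\1_`]a, b]%classic) t = (cos (t * a) - cos (t * b)) / t.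
Proof.
move=> ab t0.
have cf : continuous (fun s => sin (t * s)).
  by move=> s; apply: continuous_comp; [exact: mulrl_continuous|exact: continuous_sin].
have dF s : is_derive (s : R^o) (1 : R^o) (fun s => - t^-1 * cos (t * s)) (sin (t * s)).
  have := is_derive_scale (- t^-1)
    (is_derive1_comp (is_derive_cos (t * s)) (is_derive_mul t s)).
  by rewrite mulrA mulrNN mulrAC mulVf// mul1r.
by rewrite /sintr (mint_itv_FTC ab cf dF) -mulrBr mulrC mulrN -mulNr opprB.
Qed.
End transforms.

(** * Plancherel's formula for step functions *)

Section Plancherel_step.
Context {R : realType}.
Implicit Types u v f g : R -> R.

Lemma lebesgue_ae_mono (P Q : R -> Prop) : (forall x, P x -> Q x) ->
  {ae @lebesgue_measure R, forall x, P x} -> {ae @lebesgue_measure R, forall x, Q x}.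
Proof. by move=> PQ; apply: negligibleS => x; apply: contra_not; exact: PQ. Qed.

Lemma mint_eq0 f : (forall x, f x = 0) -> \int[lebesgue_measure]_x f x = 0.
Proof. by move=> /funext ->; rewrite Rintegral_cst// mul0r. Qed.

Lemma mint_ae f g : measurable_fun setT f -> measurable_fun setT g ->
  {ae @lebesgue_measure R, forall x, f x = g x} ->
  \int[lebesgue_measure]_x f x = \int[lebesgue_measure]_x g x.
Proof.
move=> mf mg fg; congr fine; apply: ae_eq_integral => //.
- exact/measurable_EFinP.
- exact/measurable_EFinP.
- by apply: lebesgue_ae_mono fg => x e _; rewrite e.
Qed.

Lemma L1_ae f g : measurable_fun setT f ->
  {ae @lebesgue_measure R, forall x, f x = g x} -> L1 g -> L1 f.
Proof.
move=> mf fg gi; have mg := L1_measurable gi.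
apply/integrableP; split; first exact/measurable_EFinP.
move/integrableP : gi => [_]; congr (_ < _)%E.
apply: ae_eq_integral => //.
- by apply/measurable_EFinP; exact: measurableT_comp.
- by apply/measurable_EFinP; exact: measurableT_comp.
- by apply: lebesgue_ae_mono fg => x e _; rewrite /= e.
Qed.

Lemma ae_neq0 (P : R -> Prop) : (forall t, t != 0 -> P t) ->
  {ae @lebesgue_measure R, forall t, P t}.
Proof.
move=> Pt; exists [set 0]; split => //; first exact: lebesgue_measure_set1.
by move=> t /=; apply: contra_notP => /eqP; exact: Pt.
Qed.

(** The closed formulas for the transforms of an interval hold off [t = 0] only; a single point does
    not affect measurability. *)
Lemma measurable_neq0 f g : measurable_fun setT g ->
  (forall t, t != 0 -> f t = g t) -> measurable_fun setT f.
Proof.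
move=> mg fg.
have -> : f = fun t => if t == 0 then f 0 else g t.
  by apply/funext => t; case: eqVneq => [->|/fg].
apply: measurable_fun_ifT => //.
by apply: measurable_fun_eqr => //; exact: measurable_id.
Qed.

(** The real part of the transform of [u] times the conjugate of that of [v]. The imaginary part is
    odd in [t] and is treated separately as [cross]. *)
Definition pairing u v t := costr u t * costr v t + sintr u t * sintr v t.

(** Measurability of the transforms is carried along with the two integrability conditions: it is
    explicit for intervals and passes to linear combinations and pointwise limits. *)
Definition L12 u := [/\ L1 u, L1 (fun s => u s ^+ 2),
  measurable_fun setT (costr u) & measurable_fun setT (sintr u)].

(** Plancherel's formula for one pair; with kappa equal to [pi] its constant is the usual [2 pi]. *)
Definition isometric u v := L1 (pairing u v) /\
  \int[lebesgue_measure]_t pairing u v t =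
  2 * coskappa R * \int[lebesgue_measure]_s (u s * v s).

Lemma L1M u v : measurable_fun setT u -> measurable_fun setT v ->
  L1 (fun s => u s ^+ 2) -> L1 (fun s => v s ^+ 2) -> L1 (fun s => u s * v s).
Proof.
move=> mu mv u2 v2; apply: L1_le (L1D u2 v2); first exact: measurable_funM.
move=> x; rewrite normrM -[u x ^+ 2]real_normK ?num_real//.
rewrite -[v x ^+ 2]real_normK ?num_real//.
have := sqr_ge0 (`|u x| - `|v x|); have := normr_ge0 (u x); have := normr_ge0 (v x); nra.
Qed.

Lemma L12D u v : L12 u -> L12 v -> L12 (fun s => u s + v s).
Proof.
move=> [u1 u2 cu su] [v1 v2 cv sv]; split.
- exact: L1D.
- have uv : L1 (fun s => u s * v s) by apply: L1M => //; exact: L1_measurable.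
  apply: L1_eq (L1D (L1D u2 v2) (L1Z 2 uv)) _ => s; ring.
- rewrite (_ : costr _ = costr u \+ costr v); first exact: measurable_funD.
  by apply/funext => t; rewrite costrD.
- rewrite (_ : sintr _ = sintr u \+ sintr v); first exact: measurable_funD.
  by apply/funext => t; rewrite sintrD.
Qed.

Lemma L12Z k u : L12 u -> L12 (fun s => k * u s).
Proof.
move=> [u1 u2 cu su]; split.
- exact: L1Z.
- by apply: L1_eq (L1Z (k ^+ 2) u2) _ => s; rewrite exprMn.
- rewrite (_ : costr _ = cst k \* costr u); first exact: measurable_funM.
  by apply/funext => t; rewrite costrZ.
- rewrite (_ : sintr _ = cst k \* sintr u); first exact: measurable_funM.
  by apply/funext => t; rewrite sintrZ.
Qed.

Lemma L12_0 : L12 (fun _ : R => 0).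
Proof.
split; [exact: L1_0| | |].
- by apply: L1_eq L1_0 _ => s; rewrite expr0n.
- by rewrite (_ : costr _ = cst 0)//; apply/funext => t; rewrite costr0.
- by rewrite (_ : sintr _ = cst 0)//; apply/funext => t; rewrite sintr0.
Qed.

Lemma L12M u v : L12 u -> L12 v -> L1 (fun s => u s * v s).
Proof. by move=> [u1 u2 _ _] [v1 v2 _ _]; apply: L1M => //; exact: L1_measurable. Qed.

Lemma isometricC u v : isometric u v -> isometric v u.
Proof.
have e : pairing u v =1 pairing v u by move=> t; rewrite /pairing; ring.
move=> [h1 h2]; split; first exact: L1_eq h1 e.
rewrite -(mint_eq e) h2; congr (_ * _); apply: mint_eq => s; exact: mulrC.
Qed.

Lemma isometricD u1 u2 v : L12 u1 -> L12 u2 -> L12 v ->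
  isometric u1 v -> isometric u2 v -> isometric (fun s => u1 s + u2 s) v.
Proof.
move=> l1 l2 l [h1 e1] [h2 e2].
have i1 : L1 u1 by case: l1. have i2 : L1 u2 by case: l2.
have e : (fun t => pairing u1 v t + pairing u2 v t) =1 pairing (fun s => u1 s + u2 s) v.
  by move=> t; rewrite /pairing costrD// sintrD//; ring.
split; first exact: L1_eq (L1D h1 h2) e.
rewrite -(mint_eq e) mintD// e1 e2 -mulrDr; congr (_ * _).
rewrite -mintD; [|exact: L12M|exact: L12M].
by apply: mint_eq => s; rewrite mulrDl.
Qed.

Lemma isometricZ k u v : L12 u -> L12 v ->
  isometric u v -> isometric (fun s => k * u s) v.
Proof.
move=> l1 l [h1 e1].
have i1 : L1 u by case: l1.
have e : (fun t => k * pairing u v t) =1 pairing (fun s => k * u s) v.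
  by move=> t; rewrite /pairing costrZ// sintrZ//; ring.
split; first exact: L1_eq (L1Z k h1) e.
rewrite -(mint_eq e) mintZ// e1 mulrCA; congr (_ * _).
rewrite -mintZ; last exact: L12M.
by apply: mint_eq => s; rewrite mulrA.
Qed.

Lemma L12_itv (a b : R) : a < b -> L12 (\1_`]a, b]%classic).
Proof.
move=> ab; split; first exact: L1_itv.
- apply: L1_eq (L1_itv a b) _ => s.
  by rewrite indicE; case: (s \in _); rewrite ?expr1n ?expr0n.
- apply: measurable_neq0 (fun t => costr_itv ab).
  apply: measurable_funM; last exact: measurable_invr.
  by apply: measurable_funB; under eq_fun do rewrite mulrC; exact: measurable_sinM.
- apply: measurable_neq0 (fun t => sintr_itv ab).
  apply: measurable_funM; last exact: measurable_invr.
  by apply: measurable_funB; under eq_fun do rewrite mulrC; exact: measurable_cosM.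
Qed.

(** The addition formula turns the product into a signed sum of four terms [cos (x t) / t ^ 2], with
    [x] a difference of endpoints. The signs add up to zero, so each cosine may be replaced by
    [cos - 1], which makes every term integrable. *)
Lemma pairing_itv (a b c d t : R) : a < b -> c < d -> t != 0 ->
  pairing (\1_`]a, b]%classic) (\1_`]c, d]%classic) t =
  (cosker (b - c) t + cosker (a - d) t) - (cosker (b - d) t + cosker (a - c) t).
Proof.
move=> ab cd t0; rewrite /pairing !costr_itv// !sintr_itv// /cosker.
rewrite ![(_ - _) * t]mulrBl !cosB ![t * _]mulrC; field => //.
Qed.

Lemma mint_indicE (A : set R) : measurable A ->
  \int[lebesgue_measure]_s \1_A s = fine (lebesgue_measure A).
Proof. by move=> mA; rewrite /Rintegral integral_indic// setIT. Qed.

(** The length of the overlap, written with the signs of [pairing_itv]: since the integral of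
    [cosker x] is [kappa |x|], the two sides of Plancherel's formula then agree term by term. *)
Lemma mint_itvI (a b c d : R) : a < b -> c < d ->
  \int[lebesgue_measure]_s (\1_(`]a, b]%classic) s * \1_(`]c, d]%classic) s) =
  (`|b - c| + `|a - d| - (`|b - d| + `|a - c|)) / 2.
Proof.
move=> ab cd.
have -> : (fun s => \1_(`]a, b]%classic) s * \1_(`]c, d]%classic) s) =
   \1_(`]Num.max a c, Num.min b d]%classic) :> (R -> R).
  apply/funext => s; rewrite !indicE -natrM mulnb; congr (_ _)%:R.
  apply/andP/idP; rewrite !inE/= !in_itv/= gt_max le_min.
    by move=> [/andP[-> ->] /andP[-> ->]].
  by move=> /andP[/andP[-> ->] /andP[-> ->]].
rewrite mint_indicE// (lebesgue_measure_itv `]Num.max a c, Num.min b d])/= lte_fin.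
case: ifPn => [|]; last rewrite -leNgt; rewrite -?EFinB/=.
  by case: (lerP a c) => ?; case: (lerP b d) => ?; case: (lerP b c) => ?;
    case: (lerP a d) => ? ?; lra.
by case: (lerP a c) => ?; case: (lerP b d) => ?; case: (lerP b c) => ?;
  case: (lerP a d) => ? ?; lra.
Qed.

Lemma isometric_itv (a b c d : R) : a < b -> c < d ->
  isometric (\1_`]a, b]%classic) (\1_`]c, d]%classic).
Proof.
move=> ab cd; have [_ _ c1 s1] := L12_itv ab; have [_ _ c2 s2] := L12_itv cd.
pose k t := (cosker (b - c) t + cosker (a - d) t) - (cosker (b - d) t + cosker (a - c) t).
have mp : measurable_fun setT (pairing (\1_`]a, b]%classic) (\1_`]c, d]%classic)).
  by apply: measurable_funD; apply: measurable_funM.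
have k1 x : L1 (@cosker R x) by exact: L1_cosker.
have kl : L1 k by apply: L1B; apply: L1D.
have pk := ae_neq0 (fun t => @pairing_itv a b c d t ab cd).
split; first exact: L1_ae pk kl.
rewrite (mint_ae mp (L1_measurable kl) pk) mintB; [|exact: L1D|exact: L1D].
by rewrite !mintD// !mint_cosker mint_itvI//; field.
Qed.

Inductive is_step : (R -> R) -> Prop :=
| is_step0 : is_step (fun=> 0)
| is_step_add k (a b : R) u : a < b -> is_step u ->
    is_step (fun s => k * \1_(`]a, b]%classic) s + u s).

Lemma is_step_L12 u : is_step u -> L12 u.
Proof.
elim=> [|k a b {}u ab _ lu]; first exact: L12_0.
by apply: L12D => //; apply: L12Z; exact: L12_itv.
Qed.

Lemma isometric0 v : isometric (fun=> 0) v.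
Proof.
have e : (fun=> 0) =1 pairing (fun=> 0) v.
  by move=> t; rewrite /pairing costr0 sintr0 !mul0r addr0.
split; first exact: L1_eq L1_0 e.
rewrite -(mint_eq e) !mint_eq0 ?mulr0// => s; exact: mul0r.
Qed.

Lemma is_step_isometric u v : is_step u -> is_step v -> isometric u v.
Proof.
move=> su sv; have lv := is_step_L12 sv.
elim: su => [|k a b {}u ab su IH]; first exact: isometric0.
have lu := is_step_L12 su; have l1 := L12_itv ab.
apply: isometricD => //; first exact: L12Z.
apply: isometricZ => //; apply: isometricC.
elim: {su lu IH lv} sv => [|k' c d {}v cd sv IH]; first exact: isometric0.
have lv := is_step_L12 sv; have l2 := L12_itv cd.
apply: isometricD => //; first exact: L12Z.
by apply: isometricZ => //; exact: isometric_itv.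
Qed.

End Plancherel_step.

(** * Approximation by step functions in both the [L^1] and the [L^2] sense *)

Section step_approximation.
Context {R : realType}.
Implicit Types u v f g : R -> R.

(** The [L^1] bound makes the transforms uniformly close, which gives pointwise limits; the square
    bound is the one that Plancherel's formula propagates. *)
Definition close (e : R) u v :=
  [/\ L1 (fun s => u s - v s), L1 (fun s => (u s - v s) ^+ 2),
      \int[lebesgue_measure]_s `|u s - v s| < e &
      \int[lebesgue_measure]_s (u s - v s) ^+ 2 < e].

Definition step_approx u :=
  [/\ L1 u, L1 (fun s => u s ^+ 2) &
      forall e, 0 < e -> exists2 v, is_step v & close e u v].

(** Quarters rather than halves, because squares are added through
    [(x + y) ^ 2 <= 2 x ^ 2 + 2 y ^ 2]. *)
Lemma close_trans e u v w : close (e / 4) u v -> close (e / 4) v w -> close e u w.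
Proof.
move=> [a1 a2 a3 a4] [b1 b2 b3 b4].
have E s : u s - w s = (u s - v s) + (v s - w s) by rewrite addrA subrK.
have h1 : L1 (fun s => u s - w s) by apply: L1_eq (L1D a1 b1) _ => s; rewrite E.
have h2 : L1 (fun s => (u s - w s) ^+ 2).
  apply: L1_le (L1D (L1Z 2 a2) (L1Z 2 b2)).
    by apply: measurable_funX; exact: L1_measurable h1.
  move=> s; rewrite ger0_norm ?sqr_ge0// E.
  by have := sqr_ge0 ((u s - v s) - (v s - w s)); nra.
split=> //.
- apply: (@le_lt_trans _ _ (\int[lebesgue_measure]_s (`|u s - v s| + `|v s - w s|))).
    apply: mint_le; [exact: L1_norm|by apply: L1D; exact: L1_norm|].
    by move=> s; rewrite E ler_normD.
  rewrite mintD; [|exact: L1_norm|exact: L1_norm].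
  have := mint_ge0 (fun s => normr_ge0 (u s - v s)).
  have := mint_ge0 (fun s => normr_ge0 (v s - w s)); lra.
- apply: (@le_lt_trans _ _
    (\int[lebesgue_measure]_s (2 * (u s - v s) ^+ 2 + 2 * (v s - w s) ^+ 2))).
    apply: mint_le => //; first by apply: L1D; exact: L1Z.
    move=> s; rewrite E.
    by have := sqr_ge0 ((u s - v s) - (v s - w s)); nra.
  rewrite mintD; [|exact: L1Z|exact: L1Z].
  rewrite !mintZ//; lra.
Qed.

Lemma step_approx_closed u : L1 u -> L1 (fun s => u s ^+ 2) ->
  (forall e, 0 < e -> exists2 v, step_approx v & close e u v) -> step_approx u.
Proof.
move=> u1 u2 uv; split=> // e e0.
have e4 : 0 < e / 4 by rewrite divr_gt0.
have [v [v1 v2 vs] cuv] := uv _ e4; have [w ws cvw] := vs _ e4.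
by exists w => //; exact: close_trans cvw.
Qed.

Lemma is_stepD u v : is_step u -> is_step v -> is_step (fun s => u s + v s).
Proof.
move=> su sv; elim: su => [|k a b {}u ab su IH].
  by rewrite (_ : (fun s => 0 + v s) = v)//; apply/funext => s; rewrite add0r.
rewrite (_ : (fun s => _) = fun s => k * \1_(`]a, b]%classic) s + (u s + v s)).
  exact: is_step_add.
by apply/funext => s; rewrite addrA.
Qed.

Lemma is_stepZ k u : is_step u -> is_step (fun s => k * u s).
Proof.
elim => [|c a b {}u ab su IH].
  rewrite (_ : (fun s => k * 0) = fun=> 0); first exact: is_step0.
  by apply/funext => s; rewrite mulr0.
rewrite (_ : (fun s => _) = fun s => (k * c) * \1_(`]a, b]%classic) s + k * u s).
  exact: is_step_add.
by apply/funext => s; rewrite mulrDr mulrA.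
Qed.

Lemma is_step_itv (a b : R) : is_step (\1_(`]a, b]%classic)).
Proof.
have [ab|ba] := ltP a b; last first.
  rewrite set_itv_ge ?bnd_simp -?leNgt// (_ : \1__ = fun=> 0); first exact: is_step0.
  by apply/funext => s; rewrite indicE in_set0.
rewrite (_ : \1__ = fun s => 1 * \1_(`]a, b]%classic) s + 0).
  by apply: is_step_add => //; exact: is_step0.
by apply/funext => s; rewrite mul1r addr0.
Qed.

Lemma close_refl e u : 0 < e -> close e u u.
Proof.
move=> e0; have z s : u s - u s = 0 by exact: subrr.
split.
- by apply: L1_eq L1_0 _ => s; rewrite z.
- by apply: L1_eq L1_0 _ => s; rewrite z expr0n.
- by rewrite mint_eq0// => s; rewrite z normr0.
- by rewrite mint_eq0// => s; rewrite z expr0n.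
Qed.

Lemma is_step_approx u : is_step u -> step_approx u.
Proof.
move=> su; have [? ? _ _] := is_step_L12 su; split => // e e0.
by exists u => //; exact: close_refl.
Qed.

Lemma step_approxZ k u : step_approx u -> step_approx (fun s => k * u s).
Proof.
move=> [u1 u2 us]; split; first exact: L1Z.
  by apply: L1_eq (L1Z (k ^+ 2) u2) _ => s; rewrite exprMn.
(* [M] dominates both the factor [|k|] of the [L^1] distance and the factor [k ^ 2] of the square
   distance; the 1 keeps it positive. *)
move=> e e0; pose M := 1 + `|k| + k ^+ 2.
have M0 : 0 < M by rewrite /M -addrA ltr_pwDl// addr_ge0// sqr_ge0.
have [v sv [a1 a2 a3 a4]] := us (e / M) (divr_gt0 e0 M0).
exists (fun s => k * v s); first exact: is_stepZ.
have n1 := mint_ge0 (fun s => normr_ge0 (u s - v s)).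
have n2 := mint_ge0 (fun s => sqr_ge0 (u s - v s)).
move: a3 a4; rewrite !ltr_pdivlMr// => a3 a4.
have k0 := normr_ge0 k; have k2 := sqr_ge0 k.
split.
- by apply: L1_eq (L1Z k a1) _ => s; rewrite mulrBr.
- by apply: L1_eq (L1Z (k ^+ 2) a2) _ => s; rewrite -mulrBr exprMn.
- rewrite (mint_eq (_ : _ =1 fun s => `|k| * `|u s - v s|)).
    rewrite mintZ; last exact: L1_norm.
    rewrite /M in a3; nra.
  by move=> s; rewrite -mulrBr normrM.
- rewrite (mint_eq (_ : _ =1 fun s => k ^+ 2 * (u s - v s) ^+ 2)).
    rewrite mintZ//.
    rewrite /M in a4; nra.
  by move=> s; rewrite -mulrBr exprMn.
Qed.

Lemma step_approxD u v : step_approx u -> step_approx v ->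
  step_approx (fun s => u s + v s).
Proof.
move=> [u1 u2 us] [v1 v2 vs].
have uv2 : L1 (fun s => (u s + v s) ^+ 2).
  have uv : L1 (fun s => u s * v s) by apply: L1M => //; exact: L1_measurable.
  apply: L1_eq (L1D (L1D u2 v2) (L1Z 2 uv)) _ => s; ring.
split=> //; first exact: L1D.
move=> e e0; have e4 : 0 < e / 4 by rewrite divr_gt0.
have [u' su' [a1 a2 a3 a4]] := us _ e4.
have [v' sv' [b1 b2 b3 b4]] := vs _ e4.
exists (fun s => u' s + v' s); first exact: is_stepD.
apply: (@close_trans _ _ (fun s => u' s + v s)).
  have E s : u s + v s - (u' s + v s) = u s - u' s by ring.
  rewrite /close; under eq_fun do rewrite E.
  split=> //; first by under eq_fun do rewrite E.
    by rewrite (mint_eq (_ : _ =1 fun s => `|u s - u' s|))// => s; rewrite E.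
  by rewrite (mint_eq (_ : _ =1 fun s => (u s - u' s) ^+ 2))// => s; rewrite E.
have E s : u' s + v s - (u' s + v' s) = v s - v' s by ring.
rewrite /close; under eq_fun do rewrite E.
split=> //; first by under eq_fun do rewrite E.
  by rewrite (mint_eq (_ : _ =1 fun s => `|v s - v' s|))// => s; rewrite E.
by rewrite (mint_eq (_ : _ =1 fun s => (v s - v' s) ^+ 2))// => s; rewrite E.
Qed.

Lemma step_approx0 : step_approx (fun=> 0).
Proof. exact/is_step_approx/is_step0. Qed.

Lemma step_approxB u v : step_approx u -> step_approx v ->
  step_approx (fun s => u s - v s).
Proof.
move=> su sv; have := step_approxD su (step_approxZ (-1) sv).
by under eq_fun do rewrite mulN1r.
Qed.

End step_approximation.

(** * Indicators of Borel sets of finite measure *)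

Section indicator_approximation.
Context {R : realType}.
Implicit Types (A B : set R) (u v f g : R -> R).

Lemma le_lebesgue A B : measurable A -> measurable B -> A `<=` B ->
  (lebesgue_measure A <= lebesgue_measure B)%E.
Proof. by move=> mA mB AB; rewrite le_measure ?inE. Qed.

Lemma L1_indic A : measurable A -> (lebesgue_measure A < +oo)%E ->
  L1 (\1_A : R -> R).
Proof.
by move=> mA fA; apply: ge0_L1 => //; rewrite integral_indic// setIT.
Qed.

Lemma sqr_indic A (s : R) : (\1_A s : R) ^+ 2 = \1_A s.
Proof. by rewrite indicE; case: (s \in A); rewrite ?expr1n ?expr0n. Qed.

Lemma indicB A B (s : R) : B `<=` A -> \1_A s - \1_B s = \1_(A `\` B) s :> R.
Proof.
move=> BA; rewrite !indicE in_setD.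
have [sB|sB] := boolP (s \in B); last by rewrite subr0 andbT.
by rewrite (_ : s \in A) ?subrr ?andbF// inE; apply: BA; exact: set_mem.
Qed.

Lemma close_indic e A B : measurable A -> measurable B -> B `<=` A ->
  (lebesgue_measure (A `\` B) < e%:E)%E -> close e (\1_A) (\1_B).
Proof.
move=> mA mB BA h; have mD : measurable (A `\` B) by exact: measurableD.
have l : L1 (\1_(A `\` B) : R -> R).
  by apply: L1_indic => //; rewrite (lt_trans h)// ltry.
have z : (\int[lebesgue_measure]_s \1_(A `\` B) s < e)%R.
  rewrite mint_indicE// -lte_fin fineK// ge0_fin_numE//.
  by rewrite (lt_trans h)// ltry.
split.
- by apply: L1_eq l _ => s; rewrite indicB.
- by apply: L1_eq l _ => s; rewrite indicB// sqr_indic.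
- rewrite (mint_eq (_ : _ =1 \1_(A `\` B)))// => s.
  by rewrite indicB// ger0_norm.
- rewrite (mint_eq (_ : _ =1 \1_(A `\` B)))// => s.
  by rewrite indicB// sqr_indic.
Qed.

(** Continuity from above for the remainders, which decrease to the empty set and start with finite
    measure. *)
Lemma nondecreasing_exhaust (F : (set R)^nat) (e : R) : 0 < e ->
  (forall n, measurable (F n)) -> (forall n m, (n <= m)%N -> F n `<=` F m) ->
  (lebesgue_measure (\bigcup_n F n) < +oo)%E ->
  exists n, (lebesgue_measure (\bigcup_n F n `\` F n) < e%:E)%E.
Proof.
move=> e0 mF ndF Ffin.
have mU : measurable (\bigcup_n F n) by exact: bigcupT_measurable.
pose G n := \bigcup_n F n `\` F n.
have mG n : measurable (G n) by exact: measurableD.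
have cG : (lebesgue_measure \o G) n @[n --> \oo] --> lebesgue_measure (\bigcap_n G n).
  apply: nonincreasing_cvg_mu => //.
  - by apply: le_lt_trans Ffin; apply: le_lebesgue => // x [].
  - exact: bigcapT_measurable.
  - by move=> n m nm; apply/subsetPset; apply: setDS; exact: ndF.
have G0 : \bigcap_n G n = set0.
  apply/seteqP; split => // x Gx; have [[n _ Fx] _] := Gx 0%N I.
  by have [_] := Gx n I.
rewrite G0 measure0 in cG.
have /fine_cvgP[fG /cvgrPdist_lt/(_ _ e0)[N _ hN]] := cG.
case: fG => N' _ hN'; exists (maxn N N').
have := hN _ (leq_maxl N N'); have /= fin := hN' _ (leq_maxr N N').
rewrite /= sub0r normrN -lte_fin => h.
rewrite -[X in (X < _)%E]fineK//; apply: le_lt_trans h.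
by rewrite lee_fin ler_norm.
Qed.

Lemma step_approx_indic_ext A (F : (set R)^nat) :
  (forall n, measurable (F n)) -> (forall n m, (n <= m)%N -> F n `<=` F m) ->
  A = \bigcup_n F n -> (lebesgue_measure A < +oo)%E ->
  (forall n, step_approx (\1_(F n))) -> step_approx (\1_A).
Proof.
move=> mF ndF AF fA aF.
have mA : measurable A by rewrite AF; exact: bigcupT_measurable.
have l := L1_indic mA fA.
apply: step_approx_closed => //.
  by apply: L1_eq l _ => s; rewrite sqr_indic.
move=> e e0; rewrite AF in fA; have [n hn] := nondecreasing_exhaust e0 mF ndF fA.
exists (\1_(F n)) => //; apply: close_indic => //.
  by rewrite AF => x; exists n.
by rewrite AF.
Qed.

Let J (n : nat) : set R := `]- n%:R, n%:R]%classic.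

Let finJ A n : measurable A -> (lebesgue_measure (A `&` J n) < +oo)%E.
Proof.
move=> mA; have mJ : measurable (J n) by exact: measurable_itv.
apply: (@le_lt_trans _ _ (lebesgue_measure (J n))).
  by apply: le_lebesgue => //; exact: measurableI.
by rewrite /J lebesgue_measure_itv/=; case: ifPn => // _; rewrite -EFinD ltry.
Qed.

(** Dynkin's theorem with the half-open intervals as generators. Cutting with the bounded interval
    [J n] keeps complements and countable unions of finite measure. *)
Lemma step_approx_indicI A n : measurable A -> step_approx (\1_(A `&` J n)).
Proof.
move=> mA; rewrite /= in mA.
pose P (B : set (measurableTypeR R)) := step_approx (\1_(B `&` J n)).
have mJ : measurable (J n) by exact: measurable_itv.
apply: (@dynkin_induction _ (measurableTypeR R) (@ocitv R) P) => //.
- by move=> B C oB oC; exact: ocitvI.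
- by rewrite /P setTI; exact/is_step_approx/is_step_itv.
- move=> B oB; have [[x y] _ /= xy] : ocitv (B `&` J n).
    by apply: ocitvI => //; exact: is_ocitv.
  by rewrite /P -xy; exact/is_step_approx/is_step_itv.
- move=> B mB PB; rewrite /P.
  rewrite (_ : \1__ = fun s => \1_(J n) s - \1_(B `&` J n) s).
    by apply: step_approxB => //; exact/is_step_approx/is_step_itv.
  apply/funext => s; rewrite indicB; last exact: subIsetr.
  congr (\1_ _ _); rewrite setDIr setDv setU0 setDE setIC //.
- move=> F mF tF PF; rewrite /P setI_bigcupl.
  have mFJ i : measurable (F i `&` J n) by exact: measurableI.
  pose U k := \bigcup_(i in `I_k) (F i `&` J n).
  apply: (@step_approx_indic_ext _ U).
  + by move=> k; apply: bigcup_measurable => i _; exact: mFJ.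
  + by move=> k m km; apply: bigcup_subset => i /= ik; exact: leq_trans km.
  + apply/seteqP; split => x [k].
      by move=> _ Fx; exists k.+1 => //; exists k => /=.
    by move=> _ [i _ ?]; exists i.
  + by rewrite -setI_bigcupl; apply: finJ; exact: bigcupT_measurable.
  + elim=> [|k IH].
      rewrite (_ : U _ = set0); last by apply/seteqP; split => // x [].
      rewrite (_ : \1__ = fun=> 0); first exact: step_approx0.
      by apply/funext => s; rewrite indicE in_set0.
    rewrite (_ : \1__ = fun s => \1_(U k) s + \1_(F k `&` J n) s).
      by apply: step_approxD => //; exact: PF.
    have -> : U k.+1 = U k `|` (F k `&` J n).
      apply/seteqP; split => x.
        move=> [i /=]; rewrite ltnS leq_eqVlt => /predU1P[->|ik]; first by right.
        by left; exists i.
      by move=> [[i /= ik Fx]|Fx]; [exists i => //=; exact: ltnW|exists k => /=].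
    apply/funext => s; rewrite !indicE in_setU.
    have [sU|_] /= := boolP (s \in U k); last by rewrite add0r.
    rewrite (_ : (s \in _) = false) ?addr0//; apply/negbTE/negP; rewrite inE => -[Fk _].
    move: sU; rewrite inE => -[i /= ik [Fi _]].
    have := tF i k I I; move: ik => /[swap] -> ; last by exists s.
    by rewrite ltnn.
Qed.

Lemma step_approx_indic A : measurable A -> (lebesgue_measure A < +oo)%E ->
  step_approx (\1_A).
Proof.
move=> mA fA; apply: (@step_approx_indic_ext _ (fun n => A `&` J n)) => //.
- by move=> n; apply: measurableI => //; exact: measurable_itv.
- move=> n m nm; apply: setIS; apply: subset_itv; rewrite bnd_simp ?lerN2 ler_nat//.
- by rewrite -setI_bigcupr /J bigcup_itvT setIT.
- by move=> n; exact: step_approx_indicI.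
Qed.

End indicator_approximation.

(** * Bounded measurable functions on sets of finite measure *)

Section bounded_approximation.
Context {R : realType}.
Implicit Types (A B : set R) (u v f g : R -> R).

(** Binary expansion of [f]: subtracting [c / 2] on the set where [f >= c / 2] leaves a function
    with values between 0 and [c / 2], to which the induction hypothesis applies. *)
Lemma ge0_bounded_approx A n (c : R) f : measurable A -> (lebesgue_measure A < +oo)%E ->
  measurable_fun setT f -> (forall s, 0 <= f s <= c) ->
  exists2 g, step_approx g &
    forall s, 0 <= f s * \1_A s - g s <= c / 2 ^+ n * \1_A s.
Proof.
move=> mA fA; elim: n c f => [|n IH] c f mf fc.
  exists (fun=> 0); first exact: step_approx0.
  move=> s; have /andP[f0 f1] := fc s.
  by rewrite subr0 divr1 mulr_ge0//= ler_wpM2r.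
pose B := [set s | c / 2 <= f s].
have mB : measurable B.
  by rewrite -[B]setTI; apply: measurable_fun_le.
pose f' s := f s - c / 2 * \1_B s.
have mf' : measurable_fun setT f'.
  apply: measurable_funB => //; by apply: measurable_funM.
have [s|g ag hg] := IH (c / 2) f' mf'.
  have /andP[f0 f1] := fc s; rewrite /f' indicE.
  case: (boolP (s \in B)) => sB; first by move: sB; rewrite inE /B/=; lra.
  by move/negP: sB; rewrite inE /B/= => /negP; rewrite -ltNge; lra.
exists (fun s => c / 2 * \1_(B `&` A) s + g s).
  apply: step_approxD => //; apply: step_approxZ; apply: step_approx_indic.
    exact: measurableI.
  by rewrite (le_lt_trans _ fA)//; apply: le_lebesgue => //; exact: measurableI.
move=> s; move: (hg s); rewrite /f' indicI/= mulrBl mulrA.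
rewrite (_ : f s * \1_A s - c / 2 * \1_B s * \1_A s - g s =
  f s * \1_A s - (c / 2 * \1_B s * \1_A s + g s)); last by ring.
by rewrite exprS invfM (mulrA c).
Qed.

Lemma step_approx_bounded A (M : R) f : measurable A ->
  (lebesgue_measure A < +oo)%E -> measurable_fun setT f ->
  (forall s, `|f s| <= M) -> step_approx (fun s => f s * \1_A s).
Proof.
move=> mA fA mf fM.
have M0 : 0 <= M by exact: le_trans (fM 0).
wlog f0 : M f mf {fM M0} / forall s, 0 <= f s <= M.
  move=> H.
  (* Shifting by [M] makes the function nonnegative, bounded by [M + M]; the shift is a multiple of
     the indicator of [A]. *)
  have h : step_approx (fun s => (f s + M) * \1_A s).
    apply: (H (M + M)) => [|s]; first exact: measurable_funD.
    by have := fM s; rewrite ler_norml; lra.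
  have := step_approxB h (step_approxZ M (step_approx_indic mA fA)).
  by under eq_fun do rewrite mulrDl addrK.
have l := L1_indic mA fA.
have M0 : 0 <= M by have /andP[/le_trans] := f0 0; apply.
have fl : L1 (fun s => f s * \1_A s).
  apply: L1_le (L1Z M l).
    by apply: measurable_funM => //; exact: measurable_indic.
  move=> s; have /andP[f1 f2] := f0 s.
  by rewrite ger0_norm ?mulr_ge0// ler_wpM2r.
apply: step_approx_closed => //.
  apply: L1_le (L1Z M fl); first by apply: measurable_funX; exact: L1_measurable fl.
  move=> s; have /andP[f1 f2] := f0 s.
  by rewrite ger0_norm ?sqr_ge0// exprMn sqr_indic mulrA ler_wpM2r// expr2 ler_wpM2r.
move=> e e0.
pose m := \int[lebesgue_measure]_s (\1_A s : R).
have m0 : 0 <= m by apply: mint_ge0.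
(* A uniform error [d] on [A] costs [d * m] in the [L^1] distance; [d <= 1] gives [d ^ 2 <= d], so
   the same bound serves the squares. *)
pose d := Num.min 1 (e / (m + 1)).
have d0 : 0 < d by rewrite lt_min ltr01 divr_gt0// ltr_wpDl.
have d1 : d <= 1 by rewrite ge_min lexx.
have dm : d * m < e.
  have : d <= e / (m + 1) by rewrite ge_min lexx orbT.
  rewrite ler_pdivlMr ?ltr_wpDl//; lra.
have [n hn] : exists n, M / 2 ^+ n <= d.
  exists (Num.Def.archi_bound (M / d)).
  rewrite ler_pdivrMr ?exprn_gt0// -ler_pdivrMl// mulrC ltW//.
  exact: upper_nthrootP.
have [g ag hg] := ge0_bounded_approx n mA fA mf f0.
have {}hg s : 0 <= f s * \1_A s - g s <= d * \1_A s.
  have /andP[-> h] := hg s; apply: le_trans h _; exact: ler_wpM2r.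
exists g => //.
have g1 : L1 g by case: ag.
have b1 : L1 (fun s => f s * \1_A s - g s) by exact: L1B.
have b2 : L1 (fun s => (f s * \1_A s - g s) ^+ 2).
  apply: L1_le (L1Z d l); first by apply: measurable_funX; exact: L1_measurable b1.
  move=> s; rewrite ger0_norm ?sqr_ge0//.
  have := hg s; rewrite indicE; case: (s \in A) => /=; nra.
split=> //.
- apply: le_lt_trans dm; rewrite -mintZ//; apply: mint_le => [||s].
  + exact: L1_norm.
  + exact: L1Z.
  + by have /andP[h1 h2] := hg s; rewrite ger0_norm.
- apply: le_lt_trans dm; rewrite -mintZ//; apply: mint_le => // [|s].
    exact: L1Z.
  have := hg s; rewrite indicE; case: (s \in A) => /=; nra.
Qed.

End bounded_approximation.

(** * Plancherel's formula for all functions approximated by step functions *)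

Section Plancherel.
Context {R : realType}.
Implicit Types u v f g : R -> R.

Lemma costr_close e u v t : L1 u -> L1 v -> close e u v ->
  `|costr u t - costr v t| < e.
Proof.
move=> u1 v1 [uv _ h _]; apply: le_lt_trans h.
rewrite (_ : costr u t - costr v t = costr (fun s => u s - v s) t).
  exact: normr_costr.
have {1}-> : u = (fun s => (u s - v s) + v s) by apply/funext => s; rewrite subrK.
by rewrite costrD// addrK.
Qed.

Lemma sintr_close e u v t : L1 u -> L1 v -> close e u v ->
  `|sintr u t - sintr v t| < e.
Proof.
move=> u1 v1 [uv _ h _]; apply: le_lt_trans h.
rewrite (_ : sintr u t - sintr v t = sintr (fun s => u s - v s) t).
  exact: normr_sintr.
have {1}-> : u = (fun s => (u s - v s) + v s) by apply/funext => s; rewrite subrK.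
by rewrite sintrD// addrK.
Qed.

Lemma close_le e e' u v : e <= e' -> close e u v -> close e' u v.
Proof. by move=> ee [a1 a2 a3 a4]; split=> //; exact: lt_le_trans ee. Qed.

(** The rate [1 / (n + 1)] yields pointwise convergence of the transforms, while the fixed [eta]
    bounds the square integrals uniformly in [n]. *)
Lemma step_seq u (eta : R) : 0 < eta -> step_approx u ->
  exists s_ : nat -> R -> R, forall n,
    [/\ is_step (s_ n), close n.+1%:R^-1 u (s_ n) & close eta u (s_ n)].
Proof.
move=> eta0 [_ _ us].
have h n : exists v, [/\ is_step v, close n.+1%:R^-1 u v & close eta u v].
  have [|v sv cv] := us (Num.min n.+1%:R^-1 eta).
    by rewrite lt_min eta0 invr_gt0 ltr0n.
  by exists v; split=> //; apply: close_le cv; rewrite ge_min lexx ?orbT.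
by have [s_ hs] := choice h; exists s_.
Qed.

Lemma cvg_inv_dist (x_ : nat -> R) (x : R) :
  (forall n, `|x - x_ n| < n.+1%:R^-1) -> x_ n @[n --> \oo] --> x.
Proof.
move=> h; apply/cvgrPdist_lt => e e0; near=> n.
by apply: lt_trans (h n) _; near: n; exact: near_infty_natSinv_lt (PosNum e0).
Unshelve. all: by end_near. Qed.

Lemma cvg_costr_step u (s_ : nat -> R -> R) t : L1 u ->
  (forall n, is_step (s_ n) /\ close n.+1%:R^-1 u (s_ n)) ->
  costr (s_ n) t @[n --> \oo] --> costr u t.
Proof.
move=> u1 hs; apply: cvg_inv_dist => n; have [ss cs] := hs n.
by apply: costr_close => //; have [] := is_step_L12 ss.
Qed.

Lemma cvg_sintr_step u (s_ : nat -> R -> R) t : L1 u ->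
  (forall n, is_step (s_ n) /\ close n.+1%:R^-1 u (s_ n)) ->
  sintr (s_ n) t @[n --> \oo] --> sintr u t.
Proof.
move=> u1 hs; apply: cvg_inv_dist => n; have [ss cs] := hs n.
by apply: sintr_close => //; have [] := is_step_L12 ss.
Qed.

Lemma step_approx_L12 u : step_approx u -> L12 u.
Proof.
move=> su; have [u1 u2 _] := su; have [s_ hs] := step_seq ltr01 su.
have hs' n : is_step (s_ n) /\ close n.+1%:R^-1 u (s_ n) by have [] := hs n.
split=> //.
- apply: (@measurable_fun_cvg _ _ _ _ (fun n => costr (s_ n))) => [n|t _].
    by have [/is_step_L12[]] := hs' n.
  exact: cvg_costr_step.
- apply: (@measurable_fun_cvg _ _ _ _ (fun n => sintr (s_ n))) => [n|t _].
    by have [/is_step_L12[]] := hs' n.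
  exact: cvg_sintr_step.
Qed.

Lemma measurable_pairing u v : L12 u -> L12 v -> measurable_fun setT (pairing u v).
Proof. by move=> [_ _ ? ?] [_ _ ? ?]; apply: measurable_funD; apply: measurable_funM. Qed.

Lemma pairing_ge0 u t : 0 <= pairing u u t.
Proof. by rewrite /pairing -!expr2 addr_ge0// sqr_ge0. Qed.

Lemma coskappa_ge0 : 0 <= coskappa R.
Proof. by apply: mint_ge0 => t; exact: cosker_ge0. Qed.

Lemma limn_einf_le (x_ : nat -> \bar R) (c : \bar R) :
  (forall n, (x_ n <= c)%E) -> (limn_einf x_ <= c)%E.
Proof.
move=> h; rewrite limn_einf_lim; apply: lime_le; first exact: is_cvg_einfs.
apply: nearW => n; apply: le_trans (h n).
by apply: ereal_inf_lbound; exists n => /=.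
Qed.

Lemma sqr_approx_le u v : L1 (fun s => u s ^+ 2) -> L1 (fun s => (u s - v s) ^+ 2) ->
  L1 (fun s => v s ^+ 2) ->
  \int[lebesgue_measure]_s v s ^+ 2 <=
  2 * \int[lebesgue_measure]_s u s ^+ 2 + 2 * \int[lebesgue_measure]_s (u s - v s) ^+ 2.
Proof.
move=> u2 uv v2; rewrite -!mintZ// -mintD; [|exact: L1Z|exact: L1Z].
apply: mint_le => //; first by apply: L1D; exact: L1Z.
by move=> s; have := sqr_ge0 (2 * u s - v s); nra.
Qed.

(* A non-sharp constant is enough here: it is only applied to small u. *)
Lemma pairing_bound u : step_approx u -> L1 (pairing u u) /\
  \int[lebesgue_measure]_t pairing u u t <=
  4 * coskappa R * \int[lebesgue_measure]_s u s ^+ 2.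
Proof.
move=> su; have lu := step_approx_L12 su; have [u1 u2 _ _] := lu.
have k0 := coskappa_ge0.
pose a := \int[lebesgue_measure]_s u s ^+ 2.
have mp := measurable_pairing lu lu.
have bnd eta : 0 < eta -> (\int[lebesgue_measure]_t (pairing u u t)%:E <=
    (4 * coskappa R * (a + eta))%:E)%E.
  move=> eta0; have [s_ hs] := step_seq eta0 su.
  have hs' n : is_step (s_ n) /\ close n.+1%:R^-1 u (s_ n) by have [] := hs n.
  have ls n : L12 (s_ n) by apply: is_step_L12; have [] := hs n.
  have lim t : limn_einf (fun n => (pairing (s_ n) (s_ n) t)%:E) = (pairing u u t)%:E.
    suff c : (pairing (s_ n) (s_ n) t)%:E @[n --> \oo] --> (pairing u u t)%:E.
      by have [] := cvg_limn_einf_sup c.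
    apply: cvg_EFin; first exact: nearW.
    have cc := cvg_costr_step (t := t) u1 hs'; have cs := cvg_sintr_step (t := t) u1 hs'.
    exact: (cvgD (cvgM cc cc) (cvgM cs cs)).
  pose f_ n t := (pairing (s_ n) (s_ n) t)%:E.
  have mf n : measurable_fun setT (f_ n).
    by apply/measurable_EFinP; exact: measurable_pairing.
  have f0 n t : setT t -> (0 <= f_ n t)%E by rewrite lee_fin pairing_ge0.
  have ft := fatou (@lebesgue_measure R) measurableT mf f0.
  have e : (\int[lebesgue_measure]_t (pairing u u t)%:E =
      \int[lebesgue_measure]_t limn_einf (f_^~ t))%E.
    by apply: eq_integral => t _; rewrite -lim.
  (* After Fatou's lemma it suffices to bound each step function: its square integral is at most
     [2 a + 2 eta], and the factor [2 kappa] of Plancherel's formula turns this into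
     [4 kappa (a + eta)]. *)
  rewrite e; apply: le_trans ft _.
  apply: limn_einf_le => n; rewrite /f_.
  have [ss _ [_ c2 _ c4]] := hs n; have [i1 e1] := is_step_isometric ss ss.
  rewrite -EFin_mint// lee_fin e1; have [_ s2 _ _] := ls n.
  have := sqr_approx_le u2 c2 s2.
  under [X in 2 * _ * X]mint_eq do rewrite -expr2.
  rewrite -/a => h; nra.
have l : L1 (pairing u u).
  by apply: ge0_L1 => //; [exact: pairing_ge0|rewrite (le_lt_trans (bnd 1 ltr01))// ltry].
split=> //; rewrite -/a.
apply/ler_addgt0Pr => e e0.
pose eta := e / (4 * coskappa R + 1).
have p : 0 < 4 * coskappa R + 1 by lra.
have eta0 : 0 < eta by rewrite divr_gt0.
have := bnd eta eta0; rewrite -EFin_mint// lee_fin => /le_trans; apply.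
have : eta * (4 * coskappa R + 1) = e by rewrite /eta mulfVK// gt_eqF.
nra.
Unshelve. all: by end_near. Qed.

(** The weight puts nearly all the loss on [y]: the coefficient of [x] tends to 1 with [d], so a
    crude bound on a small [y] is enough for an exact limit. *)
Lemma sqrD_le (d x y : R) : 0 < d ->
  (x + y) ^+ 2 <= (1 + d) * x ^+ 2 + (1 + d^-1) * y ^+ 2.
Proof.
move=> d0; rewrite -subr_ge0.
have -> : (1 + d) * x ^+ 2 + (1 + d^-1) * y ^+ 2 - (x + y) ^+ 2 =
  d^-1 * (d * x - y) ^+ 2 by field; rewrite gt_eqF.
by rewrite mulr_ge0 ?invr_ge0 ?sqr_ge0// ltW.
Qed.

Lemma mint_lin2_le (a b : R) f g h : L1 f -> L1 g -> L1 h ->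
  (forall s, f s <= a * g s + b * h s) ->
  \int[lebesgue_measure]_s f s <=
  a * \int[lebesgue_measure]_s g s + b * \int[lebesgue_measure]_s h s.
Proof.
move=> f1 g1 h1 fgh; rewrite -!mintZ// -mintD; [|exact: L1Z|exact: L1Z].
by apply: mint_le => //; apply: L1D; exact: L1Z.
Qed.

Lemma pairingD_le (d : R) u v t : L1 u -> L1 v -> 0 < d ->
  pairing (fun s => u s + v s) (fun s => u s + v s) t <=
  (1 + d) * pairing u u t + (1 + d^-1) * pairing v v t.
Proof.
move=> u1 v1 d0; rewrite /pairing costrD// sintrD// -!expr2.
have := sqrD_le (costr u t) (costr v t) d0.
have := sqrD_le (sintr u t) (sintr v t) d0; lra.
Qed.

(** [u] is compared with a step function [s], for which the formula is known, in both directions and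
    on both sides of the transform. The remainder [r = u - s] enters with the factor
    [C = 1 + 1 / d]; choosing it within [d / C] leaves an error of order [d]. *)
Lemma step_approx_isometric_diag u : step_approx u -> isometric u u.
Proof.
move=> su; have [lu Nu] := pairing_bound su; split=> //.
have [u1 u2 us] := su; have k0 := coskappa_ge0.
under [in RHS]mint_eq do rewrite -expr2.
set a := \int[lebesgue_measure]_s u s ^+ 2 in Nu *.
set N := \int[lebesgue_measure]_t _ in Nu *.
have a0 : 0 <= a by apply: mint_ge0 => s; exact: sqr_ge0.
have N0 : 0 <= N by apply: mint_ge0 => s; exact: pairing_ge0.
(* The sum of all error coefficients for [d <= 1]: the terms in [a] and [N] come from
   [(1 + d) ^ 2 <= 1 + 3 d], the term in kappa alone from the remainders, and the 1 makes [K]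
   positive. *)
pose K := 6 * coskappa R * a + 3 * N + 10 * coskappa R + 1.
have K0 : 0 < K by rewrite /K; nra.
suff h d : 0 < d -> d <= 1 -> `|N - 2 * coskappa R * a| <= d * K.
  apply/eqP; rewrite -subr_eq0 -normr_le0; apply/ler_addgt0Pr => e e0.
  rewrite add0r; pose d := Num.min 1 (e / K).
  have d0 : 0 < d by rewrite lt_min ltr01 divr_gt0.
  have d1 : d <= 1 by rewrite ge_min lexx.
  apply: le_trans (h d d0 d1) _; rewrite -ler_pdivlMr//.
  by rewrite ge_min lexx orbT.
move=> d0 d1; set C := 1 + d^-1.
have C0 : 0 < C by rewrite ltr_wpDr// invr_ge0 ltW.
have [s ss [r1 r2 _ hr]] := us (d / C) (divr_gt0 d0 C0).
have [s1 s2 _ _] := is_step_L12 ss; have [ls es] := is_step_isometric ss ss.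
pose r x := u x - s x.
have sr : step_approx r by apply: step_approxB => //; exact: is_step_approx.
have [lr Nr] := pairing_bound sr.
have [r'1 r'2] : L1 (fun x => - r x) /\ step_approx (fun x => - r x).
  split; first exact: L1N.
  by have := step_approxZ (-1) sr; under eq_fun do rewrite mulN1r.
have usr : u = fun x => s x + r x by apply/funext => x; rewrite /r addrC subrK.
have sur : s = fun x => u x + (- r x) by apply/funext => x; rewrite /r opprB addrC subrK.
have prN t : pairing (fun x => - r x) (fun x => - r x) t = pairing r r t.
  have e : (fun x => - r x) = fun x => -1 * r x by apply/funext => x; rewrite mulN1r.
  by rewrite e /pairing costrZ// sintrZ//; ring.
have hC : \int[lebesgue_measure]_x r x ^+ 2 * C < d by move: hr; rewrite ltr_pdivlMr.
set rho := \int[lebesgue_measure]_x r x ^+ 2 in hC Nr.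
have rho0 : 0 <= rho by apply: mint_ge0 => x; exact: sqr_ge0.
move: es; under [in RHS]mint_eq do rewrite -expr2.
set b := \int[lebesgue_measure]_x s x ^+ 2; set M := \int[lebesgue_measure]_t _ => es.
set P := \int[lebesgue_measure]_t pairing r r t in Nr.
have h1 : N <= (1 + d) * M + C * P.
  by apply: mint_lin2_le => // t; rewrite {1 2}usr; exact: pairingD_le.
have h2 : b <= (1 + d) * a + C * rho.
  apply: mint_lin2_le => // x; rewrite {1}sur -[r x ^+ 2]sqrrN; exact: sqrD_le.
have h3 : a <= (1 + d) * b + C * rho.
  by apply: mint_lin2_le => // x; rewrite {1}usr; exact: sqrD_le.
have h4 : M <= (1 + d) * N + C * P.
  by apply: mint_lin2_le => // t; rewrite {1 2}sur -prN; exact: pairingD_le.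
have CP : C * P <= 4 * coskappa R * d by nra.
have Cr : C * rho <= d by lra.
rewrite ler_norml; apply/andP; split.
- have q1 : 2 * coskappa R * a <= (1 + d) * M + 2 * coskappa R * d by nra.
  have q2 : (1 + d) * M <= (1 + d) * ((1 + d) * N + 4 * coskappa R * d) by nra.
  rewrite /K; nra.
- have q1 : M <= 2 * coskappa R * ((1 + d) * a + d) by nra.
  have q2 : (1 + d) * M <= (1 + d) * (2 * coskappa R * ((1 + d) * a + d)) by nra.
  have ka : 0 <= coskappa R * a by nra.
  rewrite /K; nra.
Qed.

(** Polarization of the diagonal case. *)
Lemma step_approx_isometric u v : step_approx u -> step_approx v -> isometric u v.
Proof.
move=> su sv; have [u1 u2 _] := su; have [v1 v2 _] := sv.
have [lu eu] := step_approx_isometric_diag su.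
have [lv ev] := step_approx_isometric_diag sv.
have suv := step_approxD su sv; have [luv euv] := step_approx_isometric_diag suv.
have uv : L1 (fun s => u s * v s) by apply: L12M; exact: step_approx_L12.
have uu : L1 (fun s => u s * u s) by apply: L12M; exact: step_approx_L12.
have vv : L1 (fun s => v s * v s) by apply: L12M; exact: step_approx_L12.
pose w s := u s + v s.
have ww : L1 (fun s => w s * w s).
  by apply: L12M; exact: step_approx_L12.
have E t : 2^-1 * (pairing w w t - (pairing u u t + pairing v v t)) = pairing u v t.
  by rewrite /pairing costrD// sintrD//; field.
have F t : 2^-1 * (w t * w t - (u t * u t + v t * v t)) = u t * v t.
  by rewrite /w; field.
have l : L1 (fun t => pairing w w t - (pairing u u t + pairing v v t)).
  by apply: L1B => //; exact: L1D.
split; first by apply: L1_eq (L1Z 2^-1 l) _ => t; exact: E.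
rewrite -(mint_eq E) mintZ// mintB//; last exact: L1D.
rewrite (mintD lu lv) eu ev euv -(mint_eq F) mintZ; last by apply: L1B => //; exact: L1D.
rewrite (mintB ww (L1D uu vv)) (mintD uu vv).
ring.
Qed.

End Plancherel.

(** * Plancherel's formula for complex-valued functions *)

Section complex_transform.
Context {R : realType}.
Implicit Types p q r : R -> R.

(** [re_tr p q] and [im_tr p q] are the real and imaginary parts of the transform of [p + i q]. *)
Definition re_tr p q t := costr p t - sintr q t.
Definition im_tr p q t := sintr p t + costr q t.

Lemma costrN p t : costr p (- t) = costr p t.
Proof. by apply: mint_eq => s; rewrite mulNr cosN. Qed.

Lemma sintrN p t : L1 p -> sintr p (- t) = - sintr p t.
Proof.
move=> p1; rewrite /sintr -mintN; last exact: L1_sintr.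
by apply: mint_eq => s; rewrite mulNr sinN mulrN.
Qed.

Definition cross p q t := sintr p t * costr q t - costr p t * sintr q t.

(** [cross p q] is odd, since cosine transforms are even and sine transforms odd; by reflection its
    integral equals its own opposite. *)
Lemma cross_null p q : step_approx p -> step_approx q ->
  L1 (cross p q) /\ \int[lebesgue_measure]_t cross p q t = 0.
Proof.
move=> sp sq; have lp := step_approx_L12 sp; have lq := step_approx_L12 sq.
have [pp _] := step_approx_isometric sp sp; have [qq _] := step_approx_isometric sq sq.
have [p1 _ cp sp'] := lp; have [q1 _ cq sq'] := lq.
have l : L1 (cross p q).
  apply: L1_le (L1D pp qq).
    by apply: measurable_funB; apply: measurable_funM.
  move=> t; rewrite /cross /pairing ler_norml.
  have := sqr_ge0 (sintr p t + costr q t); have := sqr_ge0 (sintr p t - costr q t).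
  have := sqr_ge0 (costr p t + sintr q t); have := sqr_ge0 (costr p t - sintr q t).
  by move=> *; apply/andP; split; nra.
split=> //.
have n1 : (-1 : R) != 0 by rewrite oppr_eq0 oner_eq0.
have := mint_affine 0 n1 l; rewrite normrN1 mul1r.
rewrite (mint_eq (g := fun t => - cross p q t)); last first.
  by move=> t; rewrite addr0 mulN1r /cross !costrN !sintrN//; ring.
by rewrite mintN// => h; lra.
Qed.

Lemma tr_sqnorm p q : step_approx p -> step_approx q ->
  L1 (fun t => re_tr p q t ^+ 2 + im_tr p q t ^+ 2) /\
  \int[lebesgue_measure]_t (re_tr p q t ^+ 2 + im_tr p q t ^+ 2) =
  2 * coskappa R *
    (\int[lebesgue_measure]_s p s ^+ 2 + \int[lebesgue_measure]_s q s ^+ 2).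
Proof.
move=> sp sq; have [pp ep] := step_approx_isometric sp sp.
have [qq eq] := step_approx_isometric sq sq; have [cc ec] := cross_null sp sq.
have E t : pairing p p t + pairing q q t + 2 * cross p q t =
    re_tr p q t ^+ 2 + im_tr p q t ^+ 2.
  by rewrite /pairing /cross /re_tr /im_tr; ring.
split; first by apply: L1_eq (L1D (L1D pp qq) (L1Z 2 cc)) _ => t; exact: E.
rewrite -(mint_eq E) (mintD (L1D pp qq) (L1Z 2 cc)) (mintD pp qq) mintZ// ec ep eq.
by rewrite mulr0 addr0 -mulrDr; congr (_ * (_ + _)); apply: mint_eq => s; rewrite expr2.
Qed.

(** A real [r] suffices on the right: the mother wavelet is a multiple of the transform of an
    indicator. *)
Lemma tr_inner_re p q r : step_approx p -> step_approx q -> step_approx r ->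
  L1 (fun t => re_tr p q t * costr r t + im_tr p q t * sintr r t) /\
  \int[lebesgue_measure]_t (re_tr p q t * costr r t + im_tr p q t * sintr r t) =
  2 * coskappa R * \int[lebesgue_measure]_s (p s * r s).
Proof.
move=> sp sq sr; have [pr <-] := step_approx_isometric sp sr.
have [cc ec] := cross_null sq sr.
have E t : pairing p r t - cross q r t =
    re_tr p q t * costr r t + im_tr p q t * sintr r t.
  by rewrite /pairing /cross /re_tr /im_tr; ring.
split; last by rewrite -(mint_eq E) (mintB pr cc) ec subr0.
by apply: L1_eq (L1B pr cc) _ => t; exact: E.
Qed.

Lemma tr_inner_im p q r : step_approx p -> step_approx q -> step_approx r ->
  L1 (fun t => im_tr p q t * costr r t - re_tr p q t * sintr r t) /\
  \int[lebesgue_measure]_t (im_tr p q t * costr r t - re_tr p q t * sintr r t) =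
  2 * coskappa R * \int[lebesgue_measure]_s (q s * r s).
Proof.
move=> sp sq sr; have [pr <-] := step_approx_isometric sq sr.
have [cc ec] := cross_null sp sr.
have E t : pairing q r t + cross p r t =
    im_tr p q t * costr r t - re_tr p q t * sintr r t.
  by rewrite /pairing /cross /re_tr /im_tr; ring.
split; last by rewrite -(mint_eq E) (mintD pr cc) ec addr0.
by apply: L1_eq (L1D pr cc) _ => t; exact: E.
Qed.

End complex_transform.

(** * From Lebesgue measurable sets and the completed measure to Borel sets *)

Section completed_to_Borel.
Context {R : realType}.
Implicit Types (E B N : set R).

Lemma lebesgue_measurable_Borel E : lebesgue_measurable E ->
  exists B N, [/\ measurable B, (@lebesgue_measure R).-negligible N & E = B `|` N].
Proof.
rewrite /lebesgue_measurable -completed_caratheodory_measurable.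
rewrite g_sigma_completed_algebra_genE => -[B mB [N nN <-]].
by exists B, N.
Qed.

(** The identity from the Caratheodory sigma-algebra to the Borel one; pushing the completed measure
    forward along it gives back the Lebesgue measure on Borel sets. *)
Let idB (x : caratheodory_type (@wlength R idfun)^*%mu) : measurableTypeR R := x.

Let m_idB : measurable_fun setT idB.
Proof. by move=> _ Y mY; rewrite setTI; exact: sub_caratheodory. Qed.

Lemma ge0_completed_integral (f : R -> \bar R) : measurable_fun setT f ->
  (forall x, 0 <= f x)%E ->
  (\int[@completed_lebesgue_measure R]_x f x = \int[@lebesgue_measure R]_x f x)%E.
Proof.
move=> mf f0.
have e := @ge0_integral_pushforward _ _ _ _ _ idB m_idB (@completed_lebesgue_measure R) setT f
  measurableT mf (fun x _ => f0 x).
apply: etrans (esym e) _.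
by apply: eq_measure_integral.
Qed.

Lemma completed_integral (f : R -> \bar R) : measurable_fun setT f ->
  (\int[@completed_lebesgue_measure R]_x f x = \int[@lebesgue_measure R]_x f x)%E.
Proof.
move=> mf; rewrite integralE [RHS]integralE.
congr (_ - _)%E; apply: ge0_completed_integral => //.
- exact: measurable_funepos.
- exact: measurable_funeneg.
Qed.

Lemma completed_measure_Borel E B N : measurable B ->
  (@lebesgue_measure R).-negligible N -> E = B `|` N ->
  completed_lebesgue_measure E = lebesgue_measure B.
Proof.
move=> mB /negligible_outer_measure N0 ->.
apply/eqP; rewrite eq_le; apply/andP; split.
  have := outer_measureU2 (wlength idfun)^*%mu B N.
  by rewrite [X in (_ <= _ + X)%E -> _]N0 adde0.
by apply: le_outer_measure; exact: subsetUl.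
Qed.

Lemma completed_Rintegral_indic E B N (h : R -> R) : measurable B ->
  (@lebesgue_measure R).-negligible N -> E = B `|` N -> measurable_fun setT h ->
  \int[@completed_lebesgue_measure R]_x (h x * \1_E x) =
  \int[@lebesgue_measure R]_x (h x * \1_B x).
Proof.
move=> mB nN EBN mh.
have mhB : measurable_fun setT (fun x => h x * \1_B x).
  by apply: measurable_funM => //; exact: measurable_indic.
rewrite [RHS]/Rintegral -completed_integral; last exact/measurable_EFinP.
congr fine; apply: ae_eq_integral.
- exact: measurableT.
- apply/measurable_EFinP; apply: measurable_funM.
    by apply: (measurableT_comp mh); exact: m_idB.
  apply: measurable_indic; rewrite EBN; apply: measurableU.
    exact: sub_caratheodory.
  apply: negligible_sub_caratheodory; case: nN => M [mM M0 NM].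
  by exists M; split => //; exact: sub_caratheodory.
- apply/measurable_EFinP; apply: (measurableT_comp mhB); exact: m_idB.
- case: nN => M [mM M0 NM]; exists M; split => //; first exact: sub_caratheodory.
  move=> x /= /not_implyP[_ hx]; apply: NM; apply: contrapT => Nx; apply: hx.
  congr (_ * _)%:E; rewrite EBN !indicE in_setU.
  by rewrite (_ : (x \in N) = false) ?orbF//; apply/negbTE/negP; rewrite inE.
Qed.

End completed_to_Borel.

(** * The wavelet system on the Fourier side *)

Section wavelet_transform.
Context {R : realType}.
Implicit Types (B : set R) (n l : int).
Local Open Scope complex_scope.

Definition dil B n : set R := (fun s : R => 2 ^ (- n) * s) @^-1` B.

(* The Fourier transform of psi_(n, l) is, up to a constant, mod_cos + i mod_sin. *)
Definition mod_cos B n l (s : R) : R := cos (2 ^ (- n) * l%:~R * s) * \1_(dil B n) s.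
Definition mod_sin B n l (s : R) : R := - sin (2 ^ (- n) * l%:~R * s) * \1_(dil B n) s.

Lemma exp2z_gt0 n : 0 < (2 : R) ^ n.
Proof. exact: exprz_gt0. Qed.

Lemma exp2z_neq0 n : (2 : R) ^ n != 0.
Proof. by rewrite gt_eqF// exp2z_gt0. Qed.

Lemma measurable_dil B n : measurable B -> measurable (dil B n).
Proof.
move=> mB; rewrite -[dil B n]setTI; apply: (@mulrl_measurable R setT (2 ^ (- n))) => //.
Qed.

Lemma lebesgue_dil B n : measurable B ->
  (lebesgue_measure (dil B n) = (2 ^ n)%:E * lebesgue_measure B)%E.
Proof.
move=> mB; have := lebesgue_measure_affine 0 (exp2z_neq0 (- n)) mB => <-.
rewrite gtr0_norm ?exp2z_gt0// muleA -EFinM -expfzDr ?pnatr_eq0// subrr expr0z mul1e.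
by congr (lebesgue_measure _); apply/seteqP; split => s /=; rewrite addr0.
Qed.

Lemma dil_lty B n : measurable B -> (lebesgue_measure B < +oo)%E ->
  (lebesgue_measure (dil B n) < +oo)%E.
Proof. by move=> mB fB; rewrite lebesgue_dil// lte_mul_pinfty// ltW// lte_fin exp2z_gt0. Qed.

Lemma step_approx_mod B n l : measurable B -> (lebesgue_measure B < +oo)%E ->
  step_approx (mod_cos B n l) /\ step_approx (mod_sin B n l).
Proof.
move=> mB fB; split; apply: (@step_approx_bounded _ _ 1).
- exact: measurable_dil.
- exact: dil_lty.
- exact: measurable_cosM.
- by move=> s; exact: cos_max.
- exact: measurable_dil.
- exact: dil_lty.
- by apply: measurableT_comp => //; exact: measurable_sinM.
- by move=> s; rewrite normrN; exact: sin_max.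
Qed.

(** Substituting [2 ^ (- n) s] for [s] moves the dilation from [t] to the set [B], and the shift by
    [l] becomes a modulation. *)
Lemma costr_dil B n l t : measurable B -> (lebesgue_measure B < +oo)%E ->
  costr \1_B (2 ^ n * t - l%:~R) = 2 ^ (- n) * re_tr (mod_cos B n l) (mod_sin B n l) t.
Proof.
move=> mB fB; have [[p1 _ _] [q1 _ _]] := step_approx_mod n l mB fB.
have l1 : L1 (\1_B : R -> R) by exact: L1_indic.
rewrite /costr -(mint_affine 0 (exp2z_neq0 (- n))); last exact: L1_costr.
rewrite gtr0_norm ?exp2z_gt0//; congr (_ * _).
rewrite /re_tr /costr /sintr -mintB; [|exact: L1_costr|exact: L1_sintr].
apply: mint_eq => s; rewrite addr0 mulrBl mulrACA -expfzDr ?pnatr_eq0// subrr.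
rewrite expr0z mul1r cosB /mod_cos /mod_sin (mulrA l%:~R) (mulrC l%:~R).
rewrite (_ : \1_(dil B n) s = \1_B (2 ^ (- n) * s)) //; ring.
Qed.

Lemma sintr_dil B n l t : measurable B -> (lebesgue_measure B < +oo)%E ->
  sintr \1_B (2 ^ n * t - l%:~R) = 2 ^ (- n) * im_tr (mod_cos B n l) (mod_sin B n l) t.
Proof.
move=> mB fB; have [[p1 _ _] [q1 _ _]] := step_approx_mod n l mB fB.
have l1 : L1 (\1_B : R -> R) by exact: L1_indic.
rewrite /sintr -(mint_affine 0 (exp2z_neq0 (- n))); last exact: L1_sintr.
rewrite gtr0_norm ?exp2z_gt0//; congr (_ * _).
rewrite /im_tr /costr /sintr -mintD; [|exact: L1_sintr|exact: L1_costr].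
apply: mint_eq => s; rewrite addr0 mulrBl mulrACA -expfzDr ?pnatr_eq0// subrr.
rewrite expr0z mul1r sinB /mod_cos /mod_sin (mulrA l%:~R) (mulrC l%:~R).
rewrite (_ : \1_(dil B n) s = \1_B (2 ^ (- n) * s)) //; ring.
Qed.

Lemma inverse_fourier_indic (E B N : set R) (c t : R) : measurable B ->
  (lebesgue_measure B < +oo)%E ->
  (@lebesgue_measure R).-negligible N -> E = B `|` N ->
  inverse_fourier (fun s => (c * \1_E s)%:C) t =
  ((Num.sqrt (2 * pi))^-1 * c)%:C * (costr \1_B t +i* sintr \1_B t).
Proof.
move=> mB fB nN EBN; rewrite /inverse_fourier /cintegral.
have l1 : L1 (\1_B : R -> R) by exact: L1_indic.
have mc : measurable_fun setT (fun x : R => c * cos (t * x)).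
  by apply: measurable_funM => //; exact: measurable_cosM.
have ms : measurable_fun setT (fun x : R => c * sin (t * x)).
  by apply: measurable_funM => //; exact: measurable_sinM.
have hc := completed_Rintegral_indic mB nN EBN mc.
have hs := completed_Rintegral_indic mB nN EBN ms.
rewrite (_ : \int[_]_x complex.Re _ = c * costr \1_B t); last first.
  rewrite /costr -mintZ; last exact: L1_costr.
  transitivity (\int[@completed_lebesgue_measure R]_x (c * cos (t * x) * \1_E x)).
    by apply: eq_Rintegral => x _ /=; rewrite mulr0 subr0 mulrCA (mulrC x) mulrA.
  by rewrite hc; apply: mint_eq => x; rewrite -mulrA [X in c * X]mulrC.
rewrite (_ : \int[_]_x complex.Im _ = c * sintr \1_B t); last first.
  rewrite /sintr -mintZ; last exact: L1_sintr.
  transitivity (\int[@completed_lebesgue_measure R]_x (c * sin (t * x) * \1_E x)).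
    by apply: eq_Rintegral => x _ /=; rewrite mulr0 add0r mulrCA (mulrC x) mulrA.
  by rewrite hs; apply: mint_eq => x; rewrite -mulrA [X in c * X]mulrC.
by apply/eqP; rewrite eq_complex/=; apply/andP; split; apply/eqP; ring.
Qed.

Lemma wavelet_system_tr (psi : R -> R[i]) B (k : R) n l t : measurable B ->
  (lebesgue_measure B < +oo)%E ->
  (forall t, psi t = k%:C * (costr \1_B t +i* sintr \1_B t)) ->
  wavelet_system psi (n, l) t =
  (k * 2 `^ (n%:~R / 2) * 2 ^ (- n))%:C *
    (re_tr (mod_cos B n l) (mod_sin B n l) t +i*
     im_tr (mod_cos B n l) (mod_sin B n l) t).
Proof.
move=> mB fB psiE; rewrite /wavelet_system/= psiE costr_dil// sintr_dil//.
by apply/eqP; rewrite eq_complex/=; apply/andP; split; apply/eqP; ring.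
Qed.

End wavelet_transform.

(** * Orthonormality and completeness as statements on [B] *)

Section wavelet_facts.
Context {R : realType}.
Implicit Types (B : set R) (n l : int).
Local Open Scope complex_scope.

Lemma Lfun2_sqr (h : R -> R) : measurable_fun setT h -> L1 (fun t => h t ^+ 2) ->
  h \in Lfun (@lebesgue_measure R) 2%:E.
Proof.
move=> mh h2; rewrite inE/=; apply/andP; split; rewrite inE//=.
rewrite /finite_norm unlock poweR_lty//.
under eq_integral => x _ do rewrite /= -[2]/(2%:R) powR_mulrn// real_normK ?num_real//.
exact: integrable_lty h2.
Qed.

Lemma cL2_tr (g : R -> R) : step_approx g -> cL2 (fun t => costr g t +i* sintr g t).
Proof.
move=> sg; have [_ _ mc ms] := step_approx_L12 sg; have [pg _] := step_approx_isometric sg sg.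
split; apply: Lfun2_sqr => //=.
  apply: L1_le pg; first exact: measurable_funX.
  move=> t; rewrite ger0_norm ?sqr_ge0// /pairing -!expr2.
  by rewrite lerDl sqr_ge0.
apply: L1_le pg; first exact: measurable_funX.
move=> t; rewrite ger0_norm ?sqr_ge0// /pairing -!expr2.
by rewrite lerDr sqr_ge0.
Qed.

Section orthonormal.
Variables (psi : R -> R[i]) (B : set R) (k : R).
Hypotheses (mB : measurable B) (fB : (lebesgue_measure B < +oo)%E).
Hypothesis psiE : forall t, psi t = k%:C * (costr \1_B t +i* sintr \1_B t).
Hypothesis hpsi : dyadic_orthonormal_wavelet psi.

Let K n : R := k * 2 `^ (n%:~R / 2) * 2 ^ (- n).

Let sB : step_approx \1_B.
Proof. exact: step_approx_indic. Qed.

Let sM n l : step_approx (mod_cos B n l) /\ step_approx (mod_sin B n l).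
Proof. exact: step_approx_mod. Qed.

Let w00 t : wavelet_system psi (0, 0) t = (K 0)%:C * (costr \1_B t +i* sintr \1_B t).
Proof.
rewrite (wavelet_system_tr 0 0 t mB fB psiE).
have -> : mod_cos B 0 0 = \1_B.
  by apply/funext => s; rewrite /mod_cos mulr0 mul0r cos0 mul1r /dil oppr0 expr0z/=;
    rewrite !indicE /preimage/=; under eq_set do rewrite mul1r.
have -> : mod_sin B 0 0 = fun=> 0.
  by apply/funext => s; rewrite /mod_sin mulr0 mul0r sin0 oppr0 mul0r.
by congr (_ * (_ +i* _)); rewrite /re_tr /im_tr ?sintr0 ?costr0 ?subr0 ?addr0.
Qed.

Lemma wavelet_inner n l :
  cL2_inner (wavelet_system psi (n, l)) (wavelet_system psi (0, 0)) =
  (K n * K 0 * (2 * coskappa R *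
     \int[lebesgue_measure]_s (mod_cos B n l s * \1_B s))) +i*
  (K n * K 0 * (2 * coskappa R *
     \int[lebesgue_measure]_s (mod_sin B n l s * \1_B s))).
Proof.
have [sp sq] := sM n l.
have [i1 <-] := tr_inner_re sp sq sB; have [i2 <-] := tr_inner_im sp sq sB.
rewrite /cL2_inner /cintegral -!mintZ//; congr (_ +i* _); apply: mint_eq => t.
  by rewrite (wavelet_system_tr n l t mB fB psiE) w00/= -/(K n); ring.
by rewrite (wavelet_system_tr n l t mB fB psiE) w00/= -/(K n); ring.
Qed.

(** Both are factors of the squared norm of the wavelet, which is 1. *)
Lemma wavelet_const_neq0 : K 0 != 0 /\ coskappa R != 0.
Proof.
have [_ [_ /(_ (0, 0) (0, 0)) + _]] := hpsi; rewrite wavelet_inner eqxx.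
move=> /eqP; rewrite eq_complex/= => /andP[/eqP h _]; split; apply/eqP => z.
  by move: h => /eqP; rewrite z mulr0 mul0r eq_sym oner_eq0.
by move: h => /eqP; rewrite z mulr0 mul0r mulr0 eq_sym oner_eq0.
Qed.

Let k0 : k != 0.
Proof.
have [+ _] := wavelet_const_neq0; rewrite /K.
by apply: contra_neq => ->; rewrite !mul0r.
Qed.

Let K0 n : K n != 0.
Proof. by rewrite /K !mulf_neq0 ?exp2z_neq0// gt_eqF// powR_gt0. Qed.

Lemma wavelet_orthogonal n l : (n, l) != (0, 0) ->
  \int[lebesgue_measure]_s (mod_cos B n l s * \1_B s) = 0 /\
  \int[lebesgue_measure]_s (mod_sin B n l s * \1_B s) = 0.
Proof.
have [_ [_ /(_ (n, l) (0, 0)) + _]] := hpsi; rewrite wavelet_inner => + nl.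
rewrite (negbTE nl) => /eqP; rewrite eq_complex/=.
have [_ kk0] := wavelet_const_neq0.
move: (K n) (K 0) (K0 n) (K0 0) => x y x0 y0.
by rewrite !mulf_eq0 (negbTE x0) (negbTE y0) (negbTE kk0) pnatr_eq0/= => /andP[/eqP ? /eqP ?].
Qed.

Lemma wavelet_dil_null n : n != 0 -> lebesgue_measure (dil B n `&` B) = 0%E.
Proof.
move=> n0; have [|h _] := @wavelet_orthogonal n 0; first by rewrite xpair_eqE (negbTE n0).
have mI : measurable (dil B n `&` B) by apply: measurableI => //; exact: measurable_dil.
have : \int[lebesgue_measure]_s \1_(dil B n `&` B) s = 0.
  rewrite -h; apply: mint_eq => s.
  by rewrite indicI /mod_cos mulr0 mul0r cos0 mul1r.
rewrite mint_indicE// => /eqP; rewrite fine_eq0 => [/eqP//|].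
rewrite ge0_fin_numE//; apply: le_lt_trans fB; apply: le_lebesgue => //; exact: subIsetr.
Qed.

Lemma wavelet_fourier_null l : l != 0 ->
  \int[lebesgue_measure]_s (\1_B s * cos (l%:~R * s)) = 0 /\
  \int[lebesgue_measure]_s (\1_B s * sin (l%:~R * s)) = 0.
Proof.
move=> l0; have [|hc hs] := @wavelet_orthogonal 0 l; first by rewrite xpair_eqE (negbTE l0).
have d0 : dil B 0 = B.
  by apply/seteqP; split => s; rewrite /dil/= oppr0 expr0z mul1r.
split.
  rewrite -hc; apply: mint_eq => s.
  by rewrite /mod_cos d0 oppr0 expr0z mul1r -mulrA -expr2 sqr_indic mulrC.
rewrite -[RHS]oppr0 -hs -mintN; last first.
  by apply: L12M; apply: step_approx_L12 => //; have [] := sM 0 l.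
apply: mint_eq => s.
by rewrite /mod_sin d0 oppr0 expr0z mul1r !mulNr opprK -mulrA -expr2 sqr_indic mulrC.
Qed.

(* The span of the wavelet system consists of transforms of complex functions
   orthogonal to g. *)
Let in_span (g : R -> R) (h : R -> R[i]) := exists p q,
  [/\ step_approx p, step_approx q, forall t, h t = re_tr p q t +i* im_tr p q t,
      \int[lebesgue_measure]_s (p s * g s) = 0 &
      \int[lebesgue_measure]_s (q s * g s) = 0].

Let in_span0 g : in_span g (fun=> 0).
Proof.
exists (fun=> 0), (fun=> 0); split.
- exact: step_approx0.
- exact: step_approx0.
- by move=> t; rewrite /re_tr /im_tr costr0 sintr0 subrr addr0.
- by apply: mint_eq0 => s; rewrite mul0r.
- by apply: mint_eq0 => s; rewrite mul0r.
Qed.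

Let in_spanD g h1 h2 : step_approx g -> in_span g h1 -> in_span g h2 ->
  in_span g (fun t => h1 t + h2 t).
Proof.
move=> sg [p1 [q1 [sp1 sq1 e1 a1 b1]]] [p2 [q2 [sp2 sq2 e2 a2 b2]]].
have lg := step_approx_L12 sg.
have lp1 := step_approx_L12 sp1; have lq1 := step_approx_L12 sq1.
have lp2 := step_approx_L12 sp2; have lq2 := step_approx_L12 sq2.
exists (fun s => p1 s + p2 s), (fun s => q1 s + q2 s); split.
- exact: step_approxD.
- exact: step_approxD.
- move=> t; rewrite e1 e2 /re_tr /im_tr.
  have [[? _ _ _] [? _ _ _] [? _ _ _] [? _ _ _]] := And4 lp1 lp2 lq1 lq2.
  rewrite !costrD// !sintrD//.
  by apply/eqP; rewrite eq_complex/=; apply/andP; split; apply/eqP; ring.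
- under mint_eq do rewrite mulrDl.
  by rewrite (mintD (L12M lp1 lg) (L12M lp2 lg)) a1 a2 addr0.
- under mint_eq do rewrite mulrDl.
  by rewrite (mintD (L12M lq1 lg) (L12M lq2 lg)) b1 b2 addr0.
Qed.

Let in_spanZ g (z : R[i]) h : step_approx g -> in_span g h ->
  in_span g (fun t => z * h t).
Proof.
move=> sg [p [q [sp sq e a b]]]; case: z => x y.
have lg := step_approx_L12 sg.
have lp := step_approx_L12 sp; have lq := step_approx_L12 sq.
have [[p1 _ _ _] [q1 _ _ _]] := conj lp lq.
have pg := L12M lp lg; have qg := L12M lq lg.
exists (fun s => x * p s - y * q s), (fun s => x * q s + y * p s); split.
- by apply: step_approxB; exact: step_approxZ.
- by apply: step_approxD; exact: step_approxZ.
- move=> t; rewrite e /re_tr /im_tr.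
  under [X in _ = (costr X t - _) +i* _]eq_fun do rewrite -mulNr.
  under [X in _ = _ +i* (sintr X t + _)]eq_fun do rewrite -mulNr.
  rewrite !costrD ?sintrD ?costrZ ?sintrZ//; try exact: L1Z.
  by apply/eqP; rewrite eq_complex/=; apply/andP; split; apply/eqP; ring.
- rewrite (mint_eq (g := fun s => x * (p s * g s) - y * (q s * g s))).
    by rewrite (mintB (L1Z x pg) (L1Z y qg)) !mintZ// a b !mulr0 subr0.
  by move=> s; ring.
- rewrite (mint_eq (g := fun s => x * (q s * g s) + y * (p s * g s))).
    by rewrite (mintD (L1Z x qg) (L1Z y pg)) !mintZ// a b !mulr0 addr0.
  by move=> s; ring.
Qed.

(** By density the transform of [g] is close to that of some [p + i q] with [p] and [q] orthogonal
    to [g]. By Pythagoras the squared distance from [g] to [p + i q] is at least the squared norm of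
    [g], which is therefore arbitrarily small. *)
Lemma wavelet_complete (g : R -> R) : step_approx g ->
  (forall n l, \int[lebesgue_measure]_s (mod_cos B n l s * g s) = 0 /\
               \int[lebesgue_measure]_s (mod_sin B n l s * g s) = 0) ->
  \int[lebesgue_measure]_s g s ^+ 2 = 0.
Proof.
move=> sg og; have lg := step_approx_L12 sg; have [g1 g2 _ _] := lg.
have g0 : 0 <= \int[lebesgue_measure]_s g s ^+ 2.
  by apply: mint_ge0 => s; exact: sqr_ge0.
have kk : 0 < coskappa R.
  by rewrite lt_def coskappa_ge0 andbT; have [] := wavelet_const_neq0.
apply/eqP; rewrite eq_le g0 andbT; apply/ler_addgt0Pr => e e0; rewrite add0r.
have [_ [_ _ dense]] := hpsi.
(* The tolerance is multiplied by the Plancherel constant, to leave [e] on the side of [g]. *)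
have e'0 : 0 < 2 * coskappa R * e by rewrite !mulr_gt0.
have [s [c]] := dense _ (cL2_tr sg) _ e'0.
have : in_span g (fun t => \sum_(i <- s) c i * wavelet_system psi i t).
  elim: s => [|[n l] s IH].
    by under eq_fun do rewrite big_nil; exact: in_span0.
  under eq_fun do rewrite big_cons.
  have hw : in_span g (wavelet_system psi (n, l)).
    have -> : wavelet_system psi (n, l) = fun t => (K n)%:C *
        (re_tr (mod_cos B n l) (mod_sin B n l) t +i*
         im_tr (mod_cos B n l) (mod_sin B n l) t).
      by apply/funext => t; rewrite (wavelet_system_tr n l t mB fB psiE).
    apply: in_spanZ => //; have [sp sq] := sM n l; have [a b] := og n l.
    by exists (mod_cos B n l), (mod_sin B n l).
  exact: (in_spanD sg (in_spanZ (c (n, l)) sg hw) IH).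
move=> [p [q [sp sq e1 a b]]].
have sgp := step_approxB sg sp; have sq' := step_approxZ (-1) sq.
have lp := step_approx_L12 sp; have lq := step_approx_L12 sq.
have [[p1 p2 _ _] [q1 q2 _ _]] := conj lp lq.
have [i1 E1] := tr_sqnorm sgp sq'.
rewrite /cL2_sqnorm.
under eq_integral => t _.
  rewrite e1 (_ : Normc.normc _ ^+ 2 = re_tr (fun s => g s - p s) (fun s => -1 * q s) t ^+ 2 +
     im_tr (fun s => g s - p s) (fun s => -1 * q s) t ^+ 2); last first.
    rewrite /= sqr_sqrtr ?addr_ge0 ?sqr_ge0// /re_tr /im_tr.
    have -> : (fun s => g s - p s) = (fun s => g s + -1 * p s).
      by apply/funext => x; rewrite mulN1r.
    by rewrite costrD ?sintrD ?costrZ ?sintrZ//; try (exact: L1Z); ring.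
  over.
rewrite -EFin_mint// lte_fin E1 ltr_pM2l ?mulr_gt0// => /ltW; apply: le_trans.
apply: ler_wpDr; first by apply: mint_ge0 => x; exact: sqr_ge0.
have pg : L1 (fun s => p s * g s) by exact: L12M.
have -> : \int[lebesgue_measure]_x (g x - p x) ^+ 2 =
    \int[lebesgue_measure]_x g x ^+ 2 + \int[lebesgue_measure]_x p x ^+ 2.
  have E x : (g x ^+ 2 + p x ^+ 2) - 2 * (p x * g x) = (g x - p x) ^+ 2 by ring.
  rewrite -(mint_eq E) (mintB (L1D g2 p2) (L1Z 2 pg)) (mintD g2 p2) mintZ//.
  by rewrite a mulr0 subr0.
by rewrite lerDl; apply: mint_ge0 => x; exact: sqr_ge0.
Qed.

End orthonormal.
End wavelet_facts.

(** * The dilates of [B] cover, and its translates are disjoint *)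

Section partitions.
Context {R : realType}.
Implicit Types (A F : set R) (n l k : int).

Local Notation null := (@lebesgue_measure R).-negligible.

Lemma cosD2pi_int (m : int) (x : R) : cos (x + 2 * m%:~R * pi) = cos x.
Proof.
have nat_case (i : nat) (y : R) : cos (y + 2 * i%:R * pi) = cos y.
  by rewrite -(periodicn (@cosD2pi R) i y); congr (cos _);
    rewrite -[pi *+ 2 *+ i]mulr_natl -[pi *+ 2]mulr_natl; ring.
case: (intP m) => [|i|i]; first by rewrite mulr0 mul0r addr0.
  exact: nat_case.
by rewrite -(nat_case i.+1) mulrNz mulrN mulNr subrK.
Qed.

Lemma sinD2pi_int (m : int) (x : R) : sin (x + 2 * m%:~R * pi) = sin x.
Proof.
have nat_case (i : nat) (y : R) : sin (y + 2 * i%:R * pi) = sin y.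
  by rewrite -(periodicn (@sinD2pi R) i y); congr (sin _);
    rewrite -[pi *+ 2 *+ i]mulr_natl -[pi *+ 2]mulr_natl; ring.
case: (intP m) => [|i|i]; first by rewrite mulr0 mul0r addr0.
  exact: nat_case.
by rewrite -(nat_case i.+1) mulrNz mulrN mulNr subrK.
Qed.

Lemma null_bigcup_countable (T : countType) (F : T -> set R) :
  (forall k : T, null (F k)) -> null (\bigcup_k F k).
Proof.
move=> nF; pose G (i : nat) : set R := if unpickle i is Some k then F k else set0.
apply: negligibleS (_ : null (\bigcup_i G i)).
  by move=> x [k _ Fk]; exists (pickle k) => //; rewrite /G pickleK.
apply: negligible_bigcup => i; rewrite /G; case: (unpickle i) => //.
exact: negligible_set0.
Qed.

Lemma null_ofT A : measurable A -> lebesgue_measure A = 0%E -> null A.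
Proof. by move=> mA; have [_ ] := negligibleP (@lebesgue_measure R) mA; apply. Qed.

Lemma mint_indic_eq0 A : measurable A -> (lebesgue_measure A < +oo)%E ->
  \int[lebesgue_measure]_s (\1_A s : R) = 0 -> null A.
Proof.
move=> mA fA; rewrite mint_indicE// => /eqP; rewrite fine_eq0.
  by move=> /eqP; exact: null_ofT.
by rewrite ge0_fin_numE.
Qed.

Lemma mint_null A (f g : R -> R) : null A -> measurable_fun setT f ->
  measurable_fun setT g -> (forall x, ~ A x -> f x = g x) ->
  \int[lebesgue_measure]_s f s = \int[lebesgue_measure]_s g s.
Proof.
move=> nA mf mg fg; apply: mint_ae => //.
by apply: negligibleS nA => x /= h; apply: contrapT => /fg.
Qed.

Variable B : set R.
Hypotheses (mB : measurable B) (fB : (lebesgue_measure B < +oo)%E).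
Hypothesis B_dil : forall n, n != 0 -> lebesgue_measure (dil B n `&` B) = 0%E.
Hypothesis B_complete : forall g : R -> R, step_approx g ->
  (forall n l, \int[lebesgue_measure]_s (mod_cos B n l s * g s) = 0 /\
               \int[lebesgue_measure]_s (mod_sin B n l s * g s) = 0) ->
  \int[lebesgue_measure]_s g s ^+ 2 = 0.

Let B_complete_indic A : measurable A -> (lebesgue_measure A < +oo)%E ->
  (forall n l, \int[lebesgue_measure]_s (mod_cos B n l s * \1_A s) = 0 /\
               \int[lebesgue_measure]_s (mod_sin B n l s * \1_A s) = 0) ->
  null A.
Proof.
move=> mA fA /(B_complete (step_approx_indic mA fA)) h.
apply: mint_indic_eq0 => //; rewrite -h; apply: mint_eq => s.
by rewrite sqr_indic.
Qed.

Lemma dil_cover : null (~` \bigcup_n dil B n).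
Proof.
set A := ~` _.
have mA : measurable A.
  apply: measurableC; apply: countable_bigcupT_measurable; first exact: countableP.
  by move=> n; exact: measurable_dil.
(* [A] could have infinite measure; its bounded pieces are admissible test sets. *)
have -> : A = \bigcup_(k : nat) (A `&` `](- k%:R), k%:R]).
  by rewrite -setI_bigcupr bigcup_itvT setIT.
apply: negligible_bigcup => k.
have mAk : measurable (A `&` `](- k%:R), k%:R]).
  by apply: measurableI => //; exact: measurable_itv.
have z n x : \1_(dil B n) x * \1_(A `&` `](- k%:R), k%:R]) x = 0 :> R.
  rewrite -[LHS]/((\1_(dil B n) \* \1_(A `&` `](- k%:R), k%:R])) x) -indicI indicE.
  by rewrite (_ : _ \in _ = false)//; apply/negbTE/negP;
    rewrite inE => -[dn [+ _]]; apply; exists n.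
apply: B_complete_indic => //.
  apply: (@le_lt_trans _ _ (lebesgue_measure `](- k%:R : R), k%:R])).
    by apply: le_lebesgue => //; exact: measurable_itv.
  by rewrite lebesgue_measure_itv/=; case: ifPn => // _; rewrite -EFinD ltry.
by move=> n l; split; apply: mint_eq0 => s; rewrite -mulrA z mulr0.
Qed.

Lemma null_affine A (a d : R) : a != 0 -> null A ->
  null ((fun s => a * s + d) @^-1` A).
Proof.
move=> a0 [N [mN N0 AN]]; exists ((fun s => a * s + d) @^-1` N); split.
- by rewrite -[_ @^-1` _]setTI; apply: measurable_affine => //.
- apply/eqP; have := lebesgue_measure_affine d a0 mN; rewrite N0 => /eqP.
  by rewrite mule_eq0 eqe normr_eq0 (negbTE a0).
- by move=> s /= /AN.
Qed.

Lemma null_translate A (d : R) : null A -> null ((fun s => s + d) @^-1` A).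
Proof.
move=> /(null_affine d (oner_neq0 R)); apply: negligibleS => s /=.
by rewrite mul1r.
Qed.

Lemma translate_null k : k != 0 ->
  null [set s | B s /\ B (s + 2 * k%:~R * pi)].
Proof.
move=> k0; set d := 2 * k%:~R * pi.
have d0 : d != 0 by rewrite !mulf_neq0 ?intr_eq0// gt_eqF// pi_gt0.
have nd0 : 0 < `|d| by rewrite normr_gt0.
(* Pieces of length [|d|] make [A j] disjoint from its translate by [d], so that the square of the
   test function is the sum of the two indicators, without cancellation. *)
pose I (j : int) : set R := `[j%:~R * `|d|, (j + 1)%:~R * `|d| [%classic.
pose A j := (B `&` (fun s => 1 * s + d) @^-1` B) `&` I j.
have mBd : measurable ((fun s => 1 * s + d) @^-1` B).
  by rewrite -[_ @^-1` _]setTI; apply: measurable_affine => //.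
have mA j : measurable (A j).
  apply: measurableI; first exact: measurableI. exact: measurable_itv.
suff nA j : null (A j).
  apply: negligibleS (null_bigcup_countable nA) => s [Bs Bsd].
  exists (Num.floor (s / `|d|)) => //; split; first by split; rewrite //= mul1r.
  by rewrite /I /= in_itv/= -ler_pdivlMr// -ltr_pdivrMr// floor_itv.
pose A' := (fun s => 1 * s + (- d)) @^-1` A j.
have mA' : measurable A' by rewrite -[A']setTI; apply: measurable_affine => //.
have AB : A j `<=` B by move=> s [[]].
have A'B : A' `<=` B.
  by move=> s [[_ /=]]; rewrite !mul1r subrK.
have fA : (lebesgue_measure (A j) < +oo)%E by rewrite (le_lt_trans _ fB)// le_lebesgue.
have fA' : (lebesgue_measure A' < +oo)%E by rewrite (le_lt_trans _ fB)// le_lebesgue.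
have AA' s : \1_(A j) s * \1_A' s = 0 :> R.
  rewrite -[LHS]/((\1_(A j) \* \1_A') s) -indicI indicE.
  rewrite (_ : _ \in _ = false)//; apply/negbTE/negP; rewrite inE => -[[_ +] [_ +]].
  rewrite /I /= !in_itv/= mul1r intrD mulrDl mul1r.
  by case: (ger0P d) => ? /andP[? ?] /andP[? ?]; lra.
pose g s : R := \1_(A j) s - \1_A' s.
have sA := step_approx_indic mA' fA'.
have sg : step_approx g by apply: step_approxB => //; exact: step_approx_indic.
have [g1 _ _] := sg.
have gB s : g s = \1_B s * g s.
  rewrite /g !indicE; have [_|/negP] := boolP (s \in B); first by rewrite mul1r.
  rewrite inE => nBs; rewrite mul0r.
  have -> : (s \in A j) = false by apply/negbTE/negP; rewrite inE => /AB.
  have -> : (s \in A') = false by apply/negbTE/negP; rewrite inE => /A'B.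
  by rewrite subrr.
have per (h : R -> R) (M : R) : measurable_fun setT h -> (forall s, `|h s| <= M) ->
    (forall s, h (s + d) = h s) -> \int[lebesgue_measure]_s (h s * \1_B s * g s) = 0.
  move=> mh hM hd.
  have l1 : L1 (fun s => \1_(A j) s * h s).
    by apply: (L1_bounded_mul mh hM); exact: L1_indic.
  have l2 : L1 (fun s => \1_A' s * h s).
    by apply: (L1_bounded_mul mh hM); exact: L1_indic.
  rewrite (mint_eq (g := fun s => \1_(A j) s * h s - \1_A' s * h s)); last first.
    by move=> s; rewrite -mulrA -gB mulrC mulrBl.
  rewrite (mintB l1 l2); apply/eqP; rewrite subr_eq0; apply/eqP.
  have := mint_affine (- d) (oner_neq0 R) l1; rewrite normr1 mul1r => <-.
  apply: mint_eq => s; congr (_ * _).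
  by rewrite mul1r -hd subrK.
have : \int[lebesgue_measure]_s g s ^+ 2 = 0.
  apply: B_complete => // n l.
  (* At level 0 the modulations have period [2 pi], so the two halves of [g] cancel. At any other
     level [2 ^ n B] meets [B], which carries [g], in a null set. *)
  have [n0|n0] := eqVneq n 0.
    rewrite n0; have d00 : dil B 0 = B.
      by apply/seteqP; split => s; rewrite /dil/= oppr0 expr0z mul1r.
    have arg s : 2 ^ (- (0 : int)) * l%:~R * (s + d) =
        2 ^ (- (0 : int)) * l%:~R * s + 2 * (l * k)%:~R * pi.
      by rewrite /d oppr0 expr0z mul1r intrM; ring.
    rewrite /mod_cos /mod_sin d00; split; apply: (per _ 1).
    - exact: measurable_cosM.
    - by move=> s; exact: cos_max.
    - by move=> s; rewrite arg cosD2pi_int.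
    - by apply: measurableT_comp => //; exact: measurable_sinM.
    - by move=> s; rewrite normrN; exact: sin_max.
    - by move=> s; rewrite arg sinD2pi_int.
  have nI : null (dil B n `&` B).
    apply: null_ofT; last exact: B_dil.
    by apply: measurableI => //; exact: measurable_dil.
  have z s : ~ (dil B n `&` B) s -> \1_(dil B n) s * g s = 0.
    move=> h; rewrite gB mulrA -[_ * \1_B s]/((\1_(dil B n) \* \1_B) s) -indicI indicE.
    by rewrite (_ : _ \in _ = false) ?mul0r//; apply/negbTE/negP; rewrite inE.
  have [mp mq] : measurable_fun setT (mod_cos B n l) /\ measurable_fun setT (mod_sin B n l).
    have [[p1 _ _] [q1 _ _]] := step_approx_mod n l mB fB.
    by split; exact: L1_measurable.
  have mg := L1_measurable g1.
  split; rewrite (@mint_null _ _ (fun=> 0) nI) ?mint_eq0//; try exact: measurable_funM.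
    by move=> s h; rewrite -mulrA z// mulr0.
  by move=> s h; rewrite -mulrA z// mulr0.
have l1 : L1 (\1_(A j) : R -> R) by exact: L1_indic.
have l2 : L1 (\1_A' : R -> R) by exact: L1_indic.
rewrite (mint_eq (g := fun s => \1_(A j) s + \1_A' s)); last first.
  move=> s; rewrite /g; have -> (x y : R) : (x - y) ^+ 2 = x ^+ 2 + y ^+ 2 - 2 * (x * y).
    by ring.
  by rewrite AA' !sqr_indic mulr0 subr0.
rewrite (mintD l1 l2) => /eqP.
rewrite paddr_eq0; [|exact: mint_ge0|exact: mint_ge0] => /andP[/eqP h _].
exact: mint_indic_eq0.
Qed.

End partitions.

(** * Polynomials that converge to a threshold function *)

Section trigonometric_moments.
Context {R : realType}.
Implicit Types (A F : set R) (n l k : int) (f g h : R -> R).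

Local Notation null := (@lebesgue_measure R).-negligible.

Lemma bernoulli_le (z : R) (N : nat) : -1 <= z -> 1 + N%:R * z <= (1 + z) ^+ N.
Proof.
move=> z1; elim: N => [|N IH]; first by rewrite mul0r addr0 expr0.
rewrite exprS -natr1; apply: le_trans (_ : (1 + z) * (1 + N%:R * z) <= _).
  have : 0 <= N%:R * (z ^+ 2) by rewrite mulr_ge0// sqr_ge0.
  rewrite -subr_ge0; set a := N%:R; lra.
by rewrite ler_wpM2l//; lra.
Qed.

(* The exponents are chosen so that the limit is 0 also at x = 1/2. *)
Lemma cvg_threshold (x : R) : 0 <= x <= 1 ->
  (1 - x ^+ (n * n)) ^+ (n * 2 ^ (n * n)) @[n --> \oo] --> ((x < 2^-1)%R%:R : R).
Proof.
move=> /andP[x0 x1].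
have z0 (n : nat) : 0 <= x ^+ (n * n) by rewrite exprn_ge0.
have z1 (n : nat) : x ^+ (n * n) <= 1 by rewrite exprn_ile1.
have E (n : nat) : (n * 2 ^ (n * n))%:R * x ^+ (n * n) = n%:R * (2 * x) ^+ (n * n) :> R.
  by rewrite natrM natrX -mulrA exprMn.
have [x2|x2] := ltP x 2^-1.
  have y1 : `|2 * x| < 1 by rewrite ger0_norm ?mulr_ge0//; lra.
  have half : `|2^-1 : R| < 1 by rewrite ger0_norm ?invr_ge0//; lra.
  apply: (@squeeze_cvgr nat _ _ R (fun n : nat => 1 - (2^-1 : R) ^+ n) (fun=> 1 : R)).
  - near=> n; apply/andP; split; last first.
      by apply: exprn_ile1; rewrite ?subr_ge0 ?z1// lerBlDr lerDl z0.
    have h := @bernoulli_le (- x ^+ (n * n)) (n * 2 ^ (n * n)).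
    apply: le_trans (h _); last by rewrite lerN2 z1.
    rewrite mulrN E lerD2l lerN2.
    (* Bernoulli bounds the expression below by [1 - n (2 x) ^ (n n)]; once [(2 x) ^ n <= 1 / 4],
       the subtracted term is at most [n / 4 ^ n <= 1 / 2 ^ n]. *)
    have yn : (2 * x) ^+ n <= 4^-1.
      near: n; have q : (0 : R) < 4^-1 by rewrite invr_gt0.
      have /cvgrPdist_lt/(_ _ q) := cvg_expr y1; apply: filterS => n /=.
      by rewrite sub0r normrN => /(le_lt_trans (ler_norm _))/ltW.
    rewrite exprM; apply: le_trans (_ : n%:R * 4^-1 ^+ n <= _).
      by rewrite ler_wpM2l// lerXn2r// nnegrE ?exprn_ge0 ?mulr_ge0//; lra.
    have -> : (4^-1 : R) = 2^-1 * 2^-1 by field.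
    rewrite exprMn mulrA ler_piMl ?exprn_ge0 ?invr_ge0//.
    by rewrite exprVn ler_pdivrMr ?exprn_gt0// mul1r -natrX ler_nat ltnW// ltn_expl.
  - rewrite -[X in _ --> X]subr0; apply: cvgB; first exact: cvg_cst.
    exact: cvg_expr.
  - exact: cvg_cst.
apply: (@squeeze_cvgr nat _ _ R (fun=> 0 : R) (fun n : nat => n.+1%:R^-1 : R)).
- near=> n; apply/andP; split; first by rewrite exprn_ge0// subr_ge0.
  rewrite -[leRHS]mul1r ler_pdivlMr ?ltr0n//.
  (* With [z = x ^ (n n)], multiplying by [(1 + z) ^ N] keeps the product at most 1, while Bernoulli
     makes this factor at least [n + 1], because [2 x >= 1]. *)
  apply: le_trans (_ : (1 - x ^+ (n * n)) ^+ (n * 2 ^ (n * n)) *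
      (1 + x ^+ (n * n)) ^+ (n * 2 ^ (n * n)) <= _).
    rewrite ler_wpM2l ?exprn_ge0 ?subr_ge0//.
    apply: le_trans (bernoulli_le _ _); last by rewrite (le_trans _ (z0 n))//; lra.
    rewrite E -natr1 addrC lerD2l ler_peMr// exprn_ege1//.
    by rewrite mulrC -ler_pdivrMr// mul1r.
  rewrite -exprMn exprn_ile1//; have := z0 n; have := z1 n.
    by move=> *; rewrite mulr_ge0//; lra.
  by nra.
- exact: cvg_cst.
- exact: cvg_harmonic.
Unshelve. all: by end_near. Qed.

End trigonometric_moments.

(** * Trigonometric polynomials and the torus *)

Section periodization.
Context {R : realType}.
Implicit Types (A F : set R) (l k : int) (f g h : R -> R).

Local Notation null := (@lebesgue_measure R).-negligible.

Inductive trig : (R -> R) -> Prop :=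
| trig_cos l : trig (fun s => cos (l%:~R * s))
| trig_sin l : trig (fun s => sin (l%:~R * s))
| trig_add f g : trig f -> trig g -> trig (fun s => f s + g s)
| trig_scale (c : R) f : trig f -> trig (fun s => c * f s).

Lemma trig_eq f g : trig f -> f =1 g -> trig g.
Proof. by move=> + /funext <-. Qed.

Lemma trig_cst (c : R) : trig (fun=> c).
Proof.
apply: trig_eq (trig_scale c (trig_cos 0)) _ => s.
by rewrite mul0r cos0 mulr1.
Qed.

Lemma trig_mul f g : trig f -> trig g -> trig (fun s => f s * g s).
Proof.
move=> tf tg; elim: tf => [l|l|{}f1 f2 _ IH1 _ IH2|c {}f _ IH]; last 2 first.
- by apply: trig_eq (trig_add IH1 IH2) _ => s; rewrite mulrDl.
- by apply: trig_eq (trig_scale c IH) _ => s; rewrite mulrA.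
- elim: tg => [k|k|g1 g2 _ IH1 _ IH2|c {}g _ IH].
  + apply: trig_eq (trig_scale 2^-1 (trig_add (trig_cos (l + k)) (trig_cos (l - k)))) _ => s.
    by rewrite !intrD mulrNz !mulrDl !mulNr !cosD cosN sinN; field.
  + apply: trig_eq (trig_scale 2^-1
      (trig_add (trig_sin (l + k)) (trig_scale (-1) (trig_sin (l - k))))) _ => s.
    by rewrite !intrD mulrNz !mulrDl !mulNr !sinD cosN sinN; field.
  + by apply: trig_eq (trig_add IH1 IH2) _ => s; rewrite mulrDr.
  + by apply: trig_eq (trig_scale c IH) _ => s; rewrite mulrCA.
elim: tg => [k|k|g1 g2 _ IH1 _ IH2|c {}g _ IH].
- apply: trig_eq (trig_scale 2^-1 (trig_add (trig_sin (l + k)) (trig_sin (l - k)))) _ => s.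
  by rewrite !intrD mulrNz !mulrDl !mulNr !sinD cosN sinN; field.
- apply: trig_eq (trig_scale 2^-1
    (trig_add (trig_cos (l - k)) (trig_scale (-1) (trig_cos (l + k))))) _ => s.
  by rewrite !intrD mulrNz !mulrDl !mulNr !cosD cosN sinN; field.
- by apply: trig_eq (trig_add IH1 IH2) _ => s; rewrite mulrDr.
- by apply: trig_eq (trig_scale c IH) _ => s; rewrite mulrCA.
Qed.

Lemma trig_exp f (n : nat) : trig f -> trig (fun s => f s ^+ n).
Proof.
move=> tf; elim: n => [|n IH].
  by apply: trig_eq (trig_cst 1) _ => s; rewrite expr0.
by apply: trig_eq (trig_mul tf IH) _ => s; rewrite exprS.
Qed.

Lemma trig_bounded f : trig f -> measurable_fun setT f /\ exists M, forall s, `|f s| <= M.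
Proof.
elim => [l|l|{}f g _ [mf [M hM]] _ [mg [N hN]]|c {}f _ [mf [M hM]]].
- by split; [exact: measurable_cosM|exists 1 => s; exact: cos_max].
- by split; [exact: measurable_sinM|exists 1 => s; exact: sin_max].
- split; first exact: measurable_funD.
  by exists (M + N) => s; rewrite (le_trans (ler_normD _ _))// lerD.
- split; first exact: measurable_funM.
  by exists (`|c| * M) => s; rewrite normrM ler_wpM2l.
Qed.

Lemma mint_dominated (f_ : nat -> R -> R) f g : (forall n : nat, measurable_fun setT (f_ n)) ->
  measurable_fun setT f -> L1 g -> (forall (n : nat) x, `|f_ n x| <= g x) ->
  (forall x, f_ n x @[n --> \oo] --> f x) ->
  \int[lebesgue_measure]_x f_ n x @[n --> \oo] --> \int[lebesgue_measure]_x f x.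
Proof.
move=> mf_ mf g1 fg cf.
have m1 (n : nat) : measurable_fun setT (EFin \o f_ n).
  by apply/measurable_EFinP; exact: mf_.
have m2 : measurable_fun setT (EFin \o f) by exact/measurable_EFinP.
have c1 : {ae @lebesgue_measure R, forall x, setT x ->
    (EFin \o f_ n) x @[n --> \oo] --> (EFin \o f) x}.
  by apply: aeW => x _; apply: cvg_EFin; [exact: nearW|exact: cf].
have d1 : {ae @lebesgue_measure R, forall x (n : nat), setT x ->
    (`|(EFin \o f_ n) x| <= (EFin \o g) x)%E}.
  by apply: aeW => x n _ /=; rewrite lee_fin.
have [] := @dominated_convergence _ (measurableTypeR R) R (@lebesgue_measure R) setT
  measurableT (fun n => EFin \o f_ n) (EFin \o f) (EFin \o g) m1 m2 c1 g1 d1.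
move=> fi _ c; by apply: fine_cvg; rewrite EFin_mint.
Qed.

Definition torus : set R := `[0, 2 * pi[%classic.

(** Reconciles the fundamental domain closed at 0, natural for [floor], with the intervals closed on
    the right used for the transforms. *)
Lemma mint_torus f : measurable_fun setT f ->
  \int[lebesgue_measure]_s (\1_torus s * f s) =
  \int[lebesgue_measure]_s (\1_(`]0, 2 * pi]%classic) s * f s).
Proof.
move=> mf; rewrite !mint_indic /Rintegral /torus; congr fine.
have mo : measurable_fun `]0, 2 * pi[ (EFin \o f).
  by apply/measurable_EFinP; exact: measurable_funTS.
exact: etrans (integral_itv_bndoo true true mo) (esym (integral_itv_bndoo false false mo)).
Qed.

Lemma torus_cos l : l != 0 ->
  \int[lebesgue_measure]_s (\1_torus s * cos (l%:~R * s)) = 0.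
Proof.
move=> l0; rewrite mint_torus; last exact: measurable_cosM.
have lr : (l%:~R : R) != 0 by rewrite intr_eq0.
have := costr_itv (a := 0) (b := 2 * pi) _ lr; rewrite /costr => -> //.
  by have := sinD2pi_int l (0 : R); rewrite add0r mulrCA mulrA => ->;
    rewrite mulr0 subrr mul0r.
by rewrite mulr_gt0// pi_gt0.
Qed.

Lemma torus_sin l : l != 0 ->
  \int[lebesgue_measure]_s (\1_torus s * sin (l%:~R * s)) = 0.
Proof.
move=> l0; rewrite mint_torus; last exact: measurable_sinM.
have lr : (l%:~R : R) != 0 by rewrite intr_eq0.
have := sintr_itv (a := 0) (b := 2 * pi) _ lr; rewrite /sintr => -> //.
  by have := cosD2pi_int l (0 : R); rewrite add0r mulrCA mulrA => ->;
    rewrite mulr0 subrr mul0r.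
by rewrite mulr_gt0// pi_gt0.
Qed.

Definition torus_proj (s : R) : R := s - 2 * (Num.floor (s / (2 * pi)))%:~R * pi.

Lemma torus_projP s : torus (torus_proj s).
Proof.
have p0 : 0 < 2 * pi :> R by rewrite mulr_gt0// pi_gt0.
have := floor_itv (s / (2 * pi)); rewrite /torus /torus_proj /= in_itv/= intrD.
rewrite ler_pdivlMr// ltr_pdivrMr//; set j := _%:~R; lra.
Qed.

Lemma measurable_torus_proj : measurable_fun setT torus_proj.
Proof.
apply: measurable_funB => //.
have p0 : 0 < 2 * pi :> R by rewrite mulr_gt0// pi_gt0.
apply: measurable_funM => //; apply: measurable_funM => //.
apply: nondecreasing_measurable => // x y xy.
rewrite ler_int; apply: le_floor; rewrite ler_pM2r ?invr_gt0//.
Qed.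

End periodization.

(** * The periodization of [B] is constant, so its translates cover *)

Section torus_cover.
Context {R : realType}.
Implicit Types (A F : set R) (l k : int) (f g h : R -> R).

Local Notation null := (@lebesgue_measure R).-negligible.

Lemma L1_torus : L1 (\1_torus : R -> R).
Proof. exact: integrable_indic_itv. Qed.

Lemma mint_torus1 : \int[lebesgue_measure]_s (\1_(@torus R) s : R) = 2 * pi.
Proof.
have p0 : 0 < 2 * pi :> R by rewrite mulr_gt0// pi_gt0.
rewrite mint_indicE; last exact: measurable_itv.
by rewrite (lebesgue_measure_itv `[0, 2 * pi[)/= lte_fin p0/= subr0.
Qed.

Lemma normr_indicM A (M s y : R) : `|y| <= M -> `|\1_A s * y| <= M * \1_A s.
Proof. by move=> yM; rewrite normrM mulrC [X in _ * X]ger0_norm// ler_wpM2r. Qed.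

Lemma trig_proj f s : trig f -> f (torus_proj s) = f s.
Proof.
have e l : l%:~R * torus_proj s =
    l%:~R * s + 2 * (- (l * Num.floor (s / (2 * pi))))%:~R * pi.
  by rewrite /torus_proj mulrNz intrM; ring.
elim=> [l|l|{}f g _ -> _ ->|a {}f _ ->] //.
- by rewrite e cosD2pi_int.
- by rewrite e sinD2pi_int.
Qed.

Variable B : set R.
Hypotheses (mB : measurable B) (fB : (lebesgue_measure B < +oo)%E).
Hypothesis B_fourier : forall l, l != 0 ->
  \int[lebesgue_measure]_s (\1_B s * cos (l%:~R * s)) = 0 /\
  \int[lebesgue_measure]_s (\1_B s * sin (l%:~R * s)) = 0.

Let c : R := \int[lebesgue_measure]_s (\1_B s : R) / (2 * pi).

(** The [2 pi] periodization of the indicator of [B], tested against [h], acts as its mean [c]. The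
    periodization itself is never formed. *)
Let bal h := \int[lebesgue_measure]_s (\1_B s * h (torus_proj s)) =
  c * \int[lebesgue_measure]_s (\1_torus s * h s).

Let good (M : R) h := measurable_fun setT h /\ forall s, `|h s| <= M.

Let good_L1B M h : good M h -> L1 (fun s => \1_B s * h (torus_proj s)).
Proof.
move=> [mh hM]; apply: (@L1_bounded_mul _ M); last exact: L1_indic.
- by apply: (measurableT_comp mh); exact: measurable_torus_proj.
- by move=> s; exact: hM.
Qed.

Let good_L1P M h : good M h -> L1 (fun s => \1_torus s * h s).
Proof. by move=> [mh hM]; apply: (@L1_bounded_mul _ M) => //; exact: L1_torus. Qed.

Let balD M N f g : good M f -> good N g -> bal f -> bal g -> bal (fun s => f s + g s).
Proof.
move=> gf gg bf bg; rewrite /bal; under mint_eq do rewrite mulrDr.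
rewrite (mintD (good_L1B gf) (good_L1B gg)) bf bg.
under [in RHS]mint_eq do rewrite mulrDr.
by rewrite (mintD (good_L1P gf) (good_L1P gg)) mulrDr.
Qed.

Let balZ M (a : R) f : good M f -> bal f -> bal (fun s => a * f s).
Proof.
move=> gf bf; rewrite /bal; under mint_eq do rewrite mulrCA.
rewrite (mintZ a (good_L1B gf)) bf.
under [in RHS]mint_eq do rewrite mulrCA.
by rewrite (mintZ a (good_L1P gf)) mulrCA.
Qed.

Let bal_lim M (h_ : nat -> R -> R) h : (forall n, good M (h_ n)) ->
  measurable_fun setT h -> (forall s, h_ n s @[n --> \oo] --> h s) ->
  (forall n, bal (h_ n)) -> bal h.
Proof.
move=> gh mh ch bh.
have mT : measurable_fun setT (\1_torus : R -> R) by exact: L1_measurable L1_torus.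
have mb : measurable_fun setT (\1_B : R -> R) by exact: measurable_indic.
have c1 : \int[lebesgue_measure]_s (\1_B s * h_ n (torus_proj s)) @[n --> \oo] -->
    \int[lebesgue_measure]_s (\1_B s * h (torus_proj s)).
  apply: (@mint_dominated _ _ _ (fun s => M * \1_B s)).
  - by move=> n; exact: L1_measurable (good_L1B (gh n)).
  - apply: measurable_funM => //; apply: (measurableT_comp mh).
    exact: measurable_torus_proj.
  - exact/L1Z/L1_indic.
  - by move=> n s; apply: normr_indicM; have [_] := gh n; apply.
  - by move=> s; apply: cvgMl_tmp; exact: ch.
have c2 : \int[lebesgue_measure]_s (\1_torus s * h_ n s) @[n --> \oo] -->
    \int[lebesgue_measure]_s (\1_torus s * h s).
  apply: (@mint_dominated _ _ _ (fun s => M * \1_torus s)).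
  - by move=> n; exact: L1_measurable (good_L1P (gh n)).
  - by apply: measurable_funM.
  - exact/L1Z/L1_torus.
  - by move=> n s; apply: normr_indicM; have [_] := gh n; apply.
  - by move=> s; apply: cvgMl_tmp; exact: ch.
have c3 : \int[lebesgue_measure]_s (\1_B s * h_ n (torus_proj s)) @[n --> \oo] -->
    c * \int[lebesgue_measure]_s (\1_torus s * h s).
  rewrite (_ : (fun n => _) = fun n => c * \int[lebesgue_measure]_s (\1_torus s * h_ n s)).
    by apply: cvgMl_tmp; exact: c2.
  by apply/funext => n; exact: bh.
exact: (cvg_unique _ c1 c3).
Qed.

Let p0 : 0 < 2 * pi :> R. Proof. by rewrite mulr_gt0// pi_gt0. Qed.

(** For nonzero frequencies both sides vanish; frequency 0 is the definition of [c]. *)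
Let bal_trig f : trig f -> bal f.
Proof.
move=> tf; have : \int[lebesgue_measure]_s (\1_B s * f s) =
    c * \int[lebesgue_measure]_s (\1_torus s * f s).
  elim: tf => [l|l|{}f g tf IHf tg IHg|a {}f tf IH].
  - have [->|l0] := eqVneq l 0; last by rewrite torus_cos// mulr0; have [] := B_fourier l0.
    have e (A : set R) : \int[lebesgue_measure]_s (\1_A s * cos ((0 : int)%:~R * s)) =
        \int[lebesgue_measure]_s (\1_A s : R).
      by apply: mint_eq => s; rewrite mul0r cos0 mulr1.
    by rewrite !e mint_torus1 /c divfK// gt_eqF.
  - have [->|l0] := eqVneq l 0; last by rewrite torus_sin// mulr0; have [] := B_fourier l0.
    by rewrite !mint_eq0 ?mulr0// => s; rewrite mul0r sin0 mulr0.
  - have [mf [M fM]] := trig_bounded tf; have [mg [N gN]] := trig_bounded tg.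
    have lf A : L1 (\1_A : R -> R) -> L1 (fun s => \1_A s * f s).
      exact: (L1_bounded_mul mf fM).
    have lg A : L1 (\1_A : R -> R) -> L1 (fun s => \1_A s * g s).
      exact: (L1_bounded_mul mg gN).
    have lB := L1_indic mB fB.
    under mint_eq do rewrite mulrDr.
    rewrite (mintD (lf _ lB) (lg _ lB)) IHf IHg.
    under [in RHS]mint_eq do rewrite mulrDr.
    by rewrite (mintD (lf _ L1_torus) (lg _ L1_torus)) mulrDr.
  - have [mf [M fM]] := trig_bounded tf.
    have lf A : L1 (\1_A : R -> R) -> L1 (fun s => \1_A s * f s).
      exact: (L1_bounded_mul mf fM).
    have lB := L1_indic mB fB.
    under mint_eq do rewrite mulrCA.
    rewrite (mintZ a (lf _ lB)) IH.
    under [in RHS]mint_eq do rewrite mulrCA.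
    by rewrite (mintZ a (lf _ L1_torus)) mulrCA.
by rewrite /bal => <-; apply: mint_eq => s; rewrite trig_proj.
Qed.

Let bal_eq f g : (forall s, torus s -> f s = g s) -> bal f -> bal g.
Proof.
move=> fg; rewrite /bal.
rewrite (mint_eq (g := fun s => \1_B s * g (torus_proj s))); last first.
  by move=> s; rewrite fg//; exact: torus_projP.
move=> ->; congr (_ * _); apply: mint_eq => s; rewrite indicE.
by have [/set_mem/fg ->//|] := boolP (s \in torus); rewrite !mul0r.
Qed.

(** A trigonometric polynomial with values in [[0, 1]] that takes the value 1/2 at [0] and [b], so
    that [cvg_threshold] turns it into the indicator of a set bounded by these points. *)
Let arc (b s : R) : R := (cos (s - b / 2) - cos (b / 2)) / 4 + 2^-1.

Let trig_arc b : trig (arc b).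
Proof.
have := trig_add (trig_scale 4^-1 (trig_add
  (trig_scale (cos (b / 2)) (trig_cos 1)) (trig_scale (sin (b / 2)) (trig_sin 1))))
  (trig_cst (2^-1 - cos (b / 2) / 4)).
move/trig_eq; apply => s.
by rewrite /arc cosB !mul1r; field.
Qed.

Let arc01 b s : 0 <= arc b s <= 1.
Proof.
have h1 := cos_geN1 (s - b / 2); have h2 := cos_le1 (s - b / 2).
have h3 := cos_geN1 (b / 2); have h4 := cos_le1 (b / 2).
by rewrite /arc; lra.
Qed.

Let bal_arc b : bal (fun s => (arc b s < 2^-1)%R%:R).
Proof.
have ta (n : nat) : trig (fun s => (1 - arc b s ^+ (n * n)) ^+ (n * 2 ^ (n * n))).
  apply: trig_exp; apply: trig_eq (trig_add (trig_cst 1)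
    (trig_scale (-1) (trig_exp (n * n) (trig_arc b)))) _.
  by move=> s; rewrite mulN1r.
apply: (@bal_lim 1 (fun n s => (1 - arc b s ^+ (n * n)) ^+ (n * 2 ^ (n * n)))).
- move=> n; split; first by have [] := trig_bounded (ta n).
  move=> s; have /andP[a0 a1] := arc01 b s.
  have z0 : 0 <= arc b s ^+ (n * n) by rewrite exprn_ge0.
  have z1 : arc b s ^+ (n * n) <= 1 by rewrite exprn_ile1.
  by rewrite ger0_norm ?exprn_ge0 ?subr_ge0// exprn_ile1 ?subr_ge0// lerBlDr lerDl.
- have [ma _] := trig_bounded (trig_arc b).
  rewrite (_ : (fun s => _) = fun s => if (arc b s < 2^-1)%R then 1 else 0).
    by apply: measurable_fun_ifT => //; apply: measurable_fun_ltr.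
  by apply/funext => s; case: ifP.
- by move=> s; exact: cvg_threshold.
- by move=> n; exact: bal_trig.
Qed.

(* On the torus, {cos (s - b/2) < cos (b/2)} is the complement of the arc [0, b]. *)
Let arc_torus b s : 0 < b < 2 * pi -> torus s -> (arc b s < 2^-1) = (b < s).
Proof.
move=> /andP[b0 b1]; rewrite /torus /= in_itv/= => /andP[s0 s1].
have -> : (arc b s < 2^-1) = (cos (s - b / 2) < cos (b / 2)).
  by rewrite /arc; apply/idP/idP; lra.
have p := pi_gt0 R.
have bin : b / 2 \in `[0, pi] by rewrite in_itv/=; apply/andP; split; lra.
have [sb|sb] := leP s (b / 2 + pi).
  rewrite -cos_norm ltr_cos//; last first.
    by rewrite in_itv/= normr_ge0/= ler_norml; apply/andP; split; lra.
  by case: (ger0P (s - b / 2)) => h; apply/idP/idP; lra.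
(* Here [s - b / 2] exceeds [pi]; reflection brings it back to [[0, pi]], where the cosine
   decreases. *)
have -> : cos (s - b / 2) = cos (2 * pi - (s - b / 2)).
  have := cosD2pi_int (- 1) (s - b / 2); rewrite mulrNz mulr1z => <-.
  by rewrite -cosN; congr cos; ring.
rewrite ltr_cos//; last by rewrite in_itv/=; apply/andP; split; lra.
by apply/idP/idP; lra.
Qed.

Let good_indic A : measurable A -> good 1 (\1_A).
Proof.
move=> mA; split; first exact: measurable_indic.
by move=> s; rewrite indicE; case: (s \in A); rewrite ?normr1 ?normr0.
Qed.

Let bal_ray_pos b : 0 < b -> bal (\1_(`]b, +oo[%classic)).
Proof.
move=> b0; have [b1|b1] := ltP b (2 * pi).
  apply: bal_eq (bal_arc b) => s ts.
  by rewrite arc_torus ?b0// indicE mem_setE in_itv/= andbT.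
apply: bal_eq (bal_trig (trig_cst 0)) => s; rewrite /torus/= in_itv/= => /andP[_ s1].
by rewrite indicE mem_setE in_itv/= andbT (ltNge b) (le_trans (ltW s1) b1).
Qed.

Let bal_ray b : bal (\1_(`]b, +oo[%classic)).
Proof.
have [b0|b0|<-] := ltgtP 0 b; first exact: bal_ray_pos.
  apply: bal_eq (bal_trig (trig_cst 1)) => s; rewrite /torus/= in_itv/= => /andP[s0 _].
  by rewrite indicE mem_setE in_itv/= andbT (lt_le_trans b0).
(* The arcs need [0 < b]; the ray from 0 is reached as a limit of rays from [1 / (n + 1)]. *)
apply: (@bal_lim 1 (fun n => \1_(`]n.+1%:R^-1, +oo[%classic))).
- by move=> n; apply: good_indic; exact: measurable_itv.
- by apply: measurable_indic; exact: measurable_itv.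
- move=> s; rewrite indicE mem_setE in_itv/= andbT.
  have [s0|s0] := ltP 0 s.
    apply: cvg_near_cst; near=> n.
    rewrite indicE mem_setE in_itv/= andbT (_ : _ < s)//.
    by near: n; exact: near_infty_natSinv_lt (PosNum s0).
  apply: cvg_near_cst; apply: nearW => n.
  rewrite indicE mem_setE in_itv/= andbT.
  by rewrite ltNge (le_trans s0)// invr_ge0.
- by move=> n; apply: bal_ray_pos; rewrite invr_gt0 ltr0n.
Unshelve. all: by end_near. Qed.

(** Dynkin's theorem with open rays as generators. Disjoint unions pass to the limit by dominated
    convergence through [bal_lim]. *)
Let bal_indic A : measurable A -> bal (\1_A).
Proof.
move=> mA; rewrite /= in mA.
pose P (D : set (measurableTypeR R)) := bal (\1_D).
apply: (@dynkin_induction _ (measurableTypeR R) (@RGenOInfty.G R) P) => //.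
- exact: RGenOInfty.measurableE.
- move=> X Y [x ->] [y ->]; exists (Num.max x y).
  by apply/seteqP; split => s /=; rewrite !in_itv/= !andbT gt_max => /andP.
- by rewrite /P indicT; exact: bal_trig (trig_cst 1).
- by move=> D [x ->]; exact: bal_ray.
- move=> D mD bD; rewrite /P; have [mg gD] := good_indic mD.
  have g1 : good 1 (fun=> 1) by split => // s; rewrite normr1.
  have g2 : good 1 (fun s => -1 * \1_D s).
    by split; [exact: measurable_funM|move=> s; rewrite mulN1r normrN].
  have h := balD g1 g2 (bal_trig (trig_cst 1)) (balZ (-1) (conj mg gD) bD).
  apply: bal_eq h => s _; rewrite !indicE in_setC.
  by case: (s \in D); rewrite /= ?mulr1 ?mulr0 ?addr0 ?subrr.
- move=> F mF tF PF; rewrite /P.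
  pose U (m : nat) := \bigcup_(i in `I_m) F i.
  have mU m : measurable (U m) by apply: bigcup_measurable => i _; exact: mF.
  apply: (@bal_lim 1 (fun m => \1_(U m))).
  + by move=> m; apply: good_indic; exact: mU.
  + by have [] := good_indic (bigcupT_measurable F mF).
  + move=> s; apply: cvg_near_cst.
    have [[i _ Fi]|nF] := pselect ((\bigcup_k F k) s).
      near=> m; have Um : U m s by exists i => //=; near: m; exact: nbhs_infty_gt.
      have UF : (\bigcup_k F k) s by exists i.
      by rewrite !indicE !mem_set.
    apply: nearW => m; have nU : ~ U m s by move=> [i _ Fi]; apply: nF; exists i.
    by rewrite !indicE !memNset.
  + elim=> [|m IH].
      rewrite (_ : U _ = set0); last by apply/seteqP; split => // x [].
      by rewrite indic0; exact: bal_trig (trig_cst 0).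
    have h := balD (good_indic (mU m)) (good_indic (mF m)) IH (PF m).
    apply: bal_eq h => s _.
    have -> : U m.+1 = U m `|` F m.
      apply/seteqP; split => x.
        move=> [i /=]; rewrite ltnS leq_eqVlt => /predU1P[->|im]; first by right.
        by left; exists i.
      by move=> [[i /= im Fx]|Fx]; [exists i => //=; exact: ltnW|exists m => /=].
    rewrite !indicE in_setU.
    have [sU|_] /= := boolP (s \in U m); last by rewrite add0r.
    rewrite (_ : (s \in F m) = false) ?addr0//; apply/negbTE/negP; rewrite inE => Fm.
    move: sU; rewrite inE => -[i /= im Fi].
    have := tF i m I I; move: im => /[swap] -> ; last by exists s.
    by rewrite ltnn.
- suff : (@RGenOInfty.G R).-sigma.-measurable A by [].
  by rewrite -RGenOInfty.measurableE.
Unshelve. all: by end_near. Qed.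

Hypothesis B_pos : 0 < \int[lebesgue_measure]_s (\1_B s : R).

(** The uncovered set is stable under translations by [2 k pi] and misses [B], so the balance
    applied to it reads 0 on the left. As [c > 0], its part in the torus is null, and translates of
    that part make up the whole set. *)
Lemma translate_cover : null (~` \bigcup_k [set s | B (s + 2 * k%:~R * pi)]).
Proof.
set M := ~` _.
have mBk k : measurable [set s : R | B (s + 2 * k%:~R * pi)].
  rewrite (_ : [set _ | _] = (fun s => 1 * s + 2 * k%:~R * pi) @^-1` B).
    by rewrite -[_ @^-1` _]setTI; apply: measurable_affine.
  by apply/seteqP; split => s /=; rewrite mul1r.
have mM : measurable M.
  by apply: measurableC; apply: countable_bigcupT_measurable => //; exact: countableP.
have Mper k s : M (s + 2 * k%:~R * pi) -> M s.
  move=> Ms [j _ /= Bs]; apply: Ms; exists (j - k) => //=.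
  by rewrite intrB; move: Bs; congr B; ring.
have c0 : 0 < c by rewrite divr_gt0.
have := bal_indic mM; rewrite /bal mint_eq0; last first.
  move=> s; rewrite !indicE; have [/set_mem Bs|_] := boolP (s \in B); last by rewrite mul0r.
  rewrite memNset ?mulr0// /torus_proj -mulNr -mulrN -intrN => /Mper; apply.
  by exists 0 => //=; rewrite mulr0 mul0r addr0.
move=> /esym/eqP; rewrite mulf_eq0 (gt_eqF c0)/= => /eqP h.
have mMP : measurable (torus `&` M) by apply: measurableI => //; exact: measurable_itv.
have nMP : null (torus `&` M).
  apply: mint_indic_eq0 => //.
    apply: (@le_lt_trans _ _ (lebesgue_measure (@torus R))).
      by apply: le_lebesgue => //; exact: measurable_itv.
    by rewrite (lebesgue_measure_itv `[0, 2 * pi[)/=; case: ifPn => // _; rewrite -EFinD ltry.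
  by rewrite -h; apply: mint_eq => s; rewrite indicI.
apply: negligibleS (null_bigcup_countable (fun k => null_translate (2 * k%:~R * pi) nMP)).
move=> s Ms; exists (- Num.floor (s / (2 * pi))) => //=.
have E : s + 2 * (- Num.floor (s / (2 * pi)))%:~R * pi = torus_proj s.
  by rewrite /torus_proj mulrNz mulrN mulNr.
split; first by rewrite E; exact: torus_projP.
apply: (Mper (Num.floor (s / (2 * pi)))).
by rewrite mulrNz mulrN mulNr subrK.
Qed.

End torus_cover.

(** * Partitions off a null set, and the stability of that set *)

Section exceptional_set.
Context {R : realType}.
Implicit Types (E F Z : set R) (n k : int).

Local Notation null := (@lebesgue_measure R).-negligible.

(** The two partition properties stated pointwise. Disjointness is only required from [E] itself;
    for two arbitrary dilates or translates it follows by moving the point, once the complement of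
    [Z] is invariant. *)
Definition partitions_off E Z := forall s, ~ Z s ->
  [/\ exists n, E (2 ^ (- n) * s), exists k, E (s + 2 * k%:~R * pi),
      forall n, n != 0 -> E s -> ~ E (2 ^ (- n) * s) &
      forall k, k != 0 -> E s -> ~ E (s + 2 * k%:~R * pi)].

Lemma wavelet_set_partitions E : wavelet_set E ->
  exists2 Z, null Z & partitions_off E Z.
Proof.
move=> [mE /andP[E0 Efin] hpsi].
have [B [N [mB nN EBN]]] := lebesgue_measurable_Borel mE.
have EB := completed_measure_Borel mB nN EBN; rewrite EB in E0 Efin.
have psiE t := inverse_fourier_indic
  (Num.sqrt (fine (completed_lebesgue_measure E)))^-1 t mB Efin nN EBN.
have dilB := wavelet_dil_null mB Efin psiE hpsi.
have compl := wavelet_complete mB Efin psiE hpsi.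
have fourier := wavelet_fourier_null mB Efin psiE hpsi.
have Bpos : 0 < \int[lebesgue_measure]_s (\1_B s : R).
  by rewrite mint_indicE// fine_gt0// E0 Efin.
have nullk k : k != 0 -> null [set s | E s /\ E (s + 2 * k%:~R * pi)].
  move=> k0; have := translate_null mB Efin dilB compl k0.
  move=> /(negligibleU nN)/(negligibleU (null_translate (2 * k%:~R * pi) nN)).
  apply: negligibleS => s /=; rewrite EBN => -[[Bs|Ns] [Bs'|Ns']].
  - by right; right.
  - by left.
  - by right; left.
  - by left.
have nulln n : n != 0 -> null [set s | E s /\ E (2 ^ (- n) * s)].
  move=> n0; have : null (dil B n `&` B).
    by apply: null_ofT; [apply: measurableI => //; exact: measurable_dil|exact: dilB].
  have nN' := null_affine 0 (@exp2z_neq0 R (- n)) nN.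
  move=> /(negligibleU nN)/(negligibleU nN').
  apply: negligibleS => s /=; rewrite EBN addr0 => -[[Bs|Ns] [Bs'|Ns']].
  - by right; right.
  - by left.
  - by right; left.
  - by left.
(* The index 0 is emptied: there the overlap is [E] itself, which is not null. *)
pose Zn (n : int) := if n == 0 then set0 else [set s | E s /\ E (2 ^ (- n) * s)].
pose Zk (k : int) := if k == 0 then set0 else [set s | E s /\ E (s + 2 * k%:~R * pi)].
have nZn : null (\bigcup_n Zn n).
  apply: null_bigcup_countable => n; rewrite /Zn; case: eqVneq => [_|/nulln//].
  exact: negligible_set0.
have nZk : null (\bigcup_k Zk k).
  apply: null_bigcup_countable => k; rewrite /Zk; case: eqVneq => [_|/nullk//].
  exact: negligible_set0.
have nDC := dil_cover mB compl; have nTC := translate_cover mB Efin fourier Bpos.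
exists (((~` \bigcup_n dil B n) `|`
         (~` \bigcup_k [set s | B (s + 2 * k%:~R * pi)])) `|`
        ((\bigcup_n Zn n) `|` (\bigcup_k Zk k))).
  exact: negligibleU (negligibleU nDC nTC) (negligibleU nZn nZk).
move=> s; rewrite !not_orP => -[[/contrapT[n _ Bn] /contrapT[k _ Bk]] [hn hk]].
split.
- by exists n; rewrite EBN; left.
- by exists k; rewrite EBN; left.
- by move=> m m0 Es Em; apply: hn; exists m => //; rewrite /Zn (negbTE m0).
- by move=> m m0 Es Em; apply: hk; exists m => //; rewrite /Zk (negbTE m0).
Qed.

(* The orbit of Z under the group generated by s -> 2 s and s -> s + 2 pi lies in
   the null set of all s that some 2 ^ n s + 2 q pi with q rational puts in Z. *)
Definition hull Z : set R :=
  \bigcup_(p : int * rat) ((fun s => 2 ^ p.1 * s + 2 * ratr p.2 * pi) @^-1` Z).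

Lemma null_hull Z : null Z -> null (hull Z).
Proof.
move=> nZ; apply: null_bigcup_countable => p.
by apply: null_affine => //; exact: exp2z_neq0.
Qed.

Lemma sub_hull Z : Z `<=` hull Z.
Proof.
move=> s Zs; exists (0, 0) => //=.
by rewrite expr0z mul1r rmorph0 mulr0 mul0r addr0.
Qed.

Lemma hull_dil Z n s : hull Z (2 ^ n * s) -> hull Z s.
Proof.
move=> [[m q] _ /= h]; exists (m + n, q) => //=.
by move: h; congr Z; rewrite expfzDr ?pnatr_eq0//; ring.
Qed.

(** After dilation by [2 ^ m] the shift is [2 ^ m * 2 k pi], with [m] possibly negative: this is
    where rational coefficients come from. *)
Lemma hull_translate Z k s : hull Z (s + 2 * k%:~R * pi) -> hull Z s.
Proof.
move=> [[m q] _ /= h]; exists (m, 2 ^ m * k%:~R + q) => //=.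
move: h; congr Z; rewrite rmorphD rmorphM/= ratr_int.
have -> : ratr (2 ^ m) = 2 ^ m :> R.
  by rewrite (fmorphXz (@ratr R)) /= ratr_nat.
by ring.
Qed.

End exceptional_set.

(** * The interpolation map outside an invariant exceptional set *)

Section interpolation.
Context {R : realType}.
Variables (E F Z : set R).
Implicit Types (n k : int) (s t u : R).

Hypothesis Z_dil : forall n s, Z (2 ^ n * s) -> Z s.
Hypothesis Z_translate : forall k s, Z (s + 2 * k%:~R * pi) -> Z s.
Hypotheses (EZ : partitions_off E Z) (FZ : partitions_off F Z).

Local Notation sigma := (interpolation_map E F).
Local Notation tau := (interpolation_base F).

Lemma exp2zK n s : 2 ^ (- n) * (2 ^ n * s) = s :> R.
Proof. by rewrite mulrA -expfzDr ?pnatr_eq0// addNr expr0z mul1r. Qed.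

Lemma exp2zVK n s : 2 ^ n * (2 ^ (- n) * s) = s :> R.
Proof. by rewrite mulrA -expfzDr ?pnatr_eq0// subrr expr0z mul1r. Qed.

Lemma notin_dil n s : ~ Z s -> ~ Z (2 ^ n * s).
Proof. by move=> Zs /Z_dil. Qed.

Lemma notin_translate k s : ~ Z s -> ~ Z (s + 2 * k%:~R * pi).
Proof. by move=> Zs /Z_translate. Qed.

Lemma in_dil n s : Z s -> Z (2 ^ n * s).
Proof. by move=> Zs; apply: (@Z_dil (- n)); rewrite exp2zK. Qed.

Lemma in_translate k s : Z s -> Z (s + 2 * k%:~R * pi).
Proof.
by move=> Zs; apply: (@Z_translate (- k)); rewrite mulrNz mulrN mulNr addrK.
Qed.

Lemma dil_uniq A n m s : partitions_off A Z -> ~ Z s ->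
  A (2 ^ (- n) * s) -> A (2 ^ (- m) * s) -> n = m.
Proof.
move=> AZ Zs An Am; have [_ _ h _] := AZ _ (notin_dil (n := - n) Zs).
apply/eqP; rewrite -subr_eq0; apply: contraT => nm.
have mn : m - n != 0 by rewrite -opprB oppr_eq0.
case: (h (m - n) mn An); rewrite mulrA -expfzDr ?pnatr_eq0//.
by rewrite (_ : - (m - n) - n = - m)//; ring.
Qed.

Lemma translate_uniq A k s : partitions_off A Z -> ~ Z s ->
  A s -> A (s + 2 * k%:~R * pi) -> s + 2 * k%:~R * pi = s.
Proof.
move=> AZ Zs As Ak; have [_ _ _ h] := AZ _ Zs.
have [->|k0] := eqVneq k 0; first by rewrite mulr0 mul0r addr0.
by case: (h k k0 As Ak).
Qed.

(** All dilates of 0 coincide, so covering and disjointness contradict each other there; hence the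
    special value of sigma at 0 never intervenes off [Z]. *)
Lemma notin_neq0 s : ~ Z s -> s != 0.
Proof.
move=> Zs; apply/eqP => s0; rewrite s0 in Zs.
have [[n En] _ h _] := EZ Zs; rewrite mulr0 in En.
by have := h 1 (oner_neq0 _) En; rewrite mulr0.
Qed.

Lemma interpolation_base_orbit s : exists k, tau s = s + 2 * k%:~R * pi.
Proof.
rewrite /interpolation_base; case: xgetP => [t -> [_ //]|_].
by exists 0; rewrite mulr0 mul0r addr0.
Qed.

(** Even the default values of [xget] keep sigma inside the orbit of [s] under dilations and
    translations. The contrapositive transfers exceptional sets from images to arguments. *)
Lemma interpolation_map_in s : Z s -> Z (sigma s).
Proof.
move=> Zs; rewrite /interpolation_map; case: eqVneq => [<-//|_].
set n := xget _ _; have [k ->] := interpolation_base_orbit (2 ^ (- n) * s).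
by apply: in_dil; apply: in_translate; exact: in_dil.
Qed.

Lemma interpolation_mapE n s : ~ Z s -> E (2 ^ (- n) * s) ->
  sigma s = 2 ^ n * tau (2 ^ (- n) * s).
Proof.
move=> Zs En; rewrite /interpolation_map (negbTE (notin_neq0 Zs)).
suff -> : xget 0 [set n : int | E (2 ^ (- n) * s)] = n by [].
by apply: xget_unique => // m Em; exact: dil_uniq EZ Zs Em En.
Qed.

Lemma interpolation_map_spec n s : ~ Z s -> E (2 ^ (- n) * s) ->
  F (2 ^ (- n) * sigma s) /\
  exists k, 2 ^ (- n) * sigma s = 2 ^ (- n) * s + 2 * k%:~R * pi.
Proof.
move=> Zs En; rewrite (interpolation_mapE Zs En) exp2zK.
have [_ [k Fk] _ _] := FZ (notin_dil (n := - n) Zs).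
rewrite /interpolation_base; case: xgetP => [t _ [Ft [j tj]]|h].
  by split => //; exists j.
by case: (h (2 ^ (- n) * s + 2 * k%:~R * pi)); split => //; exists k.
Qed.

(** Rescaled by [2 ^ (- n)], both [t] and [sigma s] lie in [F] and differ by a multiple of [2 pi],
    hence coincide. *)
Lemma interpolation_map_char n k s t : ~ Z s -> E (2 ^ (- n) * s) ->
  F (2 ^ (- n) * t) -> 2 ^ (- n) * t = 2 ^ (- n) * s + 2 * k%:~R * pi ->
  sigma s = t.
Proof.
move=> Zs En Ft tk; have [Fs [j sj]] := interpolation_map_spec Zs En.
have e : 2 ^ (- n) * sigma s = 2 ^ (- n) * t + 2 * (j - k)%:~R * pi.
  by rewrite sj tk intrB; ring.
have Zt : ~ Z (2 ^ (- n) * t).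
  by rewrite tk; apply: notin_translate; exact: notin_dil.
rewrite e in Fs; have := translate_uniq FZ Zt Ft Fs; rewrite -e => h.
by rewrite -[LHS](exp2zVK n) h exp2zVK.
Qed.

Lemma interpolation_map_notin s : ~ Z s -> ~ Z (sigma s).
Proof.
move=> Zs; have [[n En] _ _ _] := EZ Zs.
have [_ [k e]] := interpolation_map_spec Zs En.
rewrite -[sigma s](exp2zVK n) e.
by apply: notin_dil; apply: notin_translate; exact: notin_dil.
Qed.

(** The common value lies in a single dilate of [F], so [s] and [s'] lie in the same dilate of [E];
    rescaled, they differ by a multiple of [2 pi]. *)
Lemma interpolation_map_inj s s' : ~ Z s -> ~ Z s' -> sigma s = sigma s' -> s = s'.
Proof.
move=> Zs Zs' ss; have [[n En] _ _ _] := EZ Zs; have [[m Em] _ _ _] := EZ Zs'.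
have [Fn [k ek]] := interpolation_map_spec Zs En.
have [Fm [j ej]] := interpolation_map_spec Zs' Em.
have nm : n = m.
  by apply: dil_uniq FZ (interpolation_map_notin Zs) Fn _; rewrite ss.
rewrite -nm -ss in ej Em.
have e : 2 ^ (- n) * s' = 2 ^ (- n) * s + 2 * (k - j)%:~R * pi.
  have -> : 2 ^ (- n) * s' = 2 ^ (- n) * sigma s - 2 * j%:~R * pi by rewrite ej addrK.
  by rewrite ek intrB; ring.
rewrite e in Em; have := translate_uniq EZ (notin_dil (n := - n) Zs) En Em.
by rewrite -e => /(congr1 (fun x => 2 ^ n * x)); rewrite !exp2zVK.
Qed.

Lemma interpolation_map_dil m s : ~ Z s -> sigma (2 ^ m * s) = 2 ^ m * sigma s.
Proof.
move=> Zs; have [[n En] _ _ _] := EZ Zs.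
have [Fn [k ek]] := interpolation_map_spec Zs En.
have e x : 2 ^ (- (m + n)) * (2 ^ m * x) = 2 ^ (- n) * x :> R.
  by rewrite mulrA -expfzDr ?pnatr_eq0//; congr (2 ^ _ * _); ring.
apply: (@interpolation_map_char (m + n) k); rewrite ?e//.
exact: notin_dil.
Qed.

Let E0 s : E s -> E (2 ^ (- (0 : int)) * s).
Proof. by rewrite oppr0 expr0z mul1r. Qed.

Lemma interpolation_map_E s : ~ Z s -> E s ->
  F (sigma s) /\ exists k, sigma s = s + 2 * k%:~R * pi.
Proof. by move=> Zs /E0 /(interpolation_map_spec Zs); rewrite oppr0 expr0z !mul1r. Qed.

Lemma interpolation_map_preimage t : ~ Z t -> F t ->
  exists e k, [/\ e = t + 2 * k%:~R * pi, E e & sigma e = t].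
Proof.
move=> Zt Ft; have [_ [k Ek] _ _] := EZ Zt.
exists (t + 2 * k%:~R * pi), k; split => //.
apply: (@interpolation_map_char 0 (- k)).
- exact: notin_translate.
- exact: E0.
- by rewrite oppr0 expr0z mul1r.
- by rewrite oppr0 expr0z !mul1r mulrNz mulrN mulNr addrK.
Qed.

Section into_union.
Hypothesis sigma_into : forall s, ~ Z s -> (E `|` F) s -> (E `|` F) (sigma s).

Lemma dilate_F_into n t : n != 0 -> ~ Z t -> F t -> E (2 ^ (- n) * t) ->
  E (sigma t) /\ exists k, sigma t = t + 2 ^ n * (2 * k%:~R * pi).
Proof.
move=> n0 Zt Ft Et; have [Fn [k ek]] := interpolation_map_spec Zt Et.
split; last by exists k; rewrite -[LHS](exp2zVK n) ek mulrDr exp2zVK.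
case: (sigma_into Zt (or_intror Ft)) => // Fs.
by have [_ _ /(_ n n0 Fs)] := FZ (interpolation_map_notin Zt).
Qed.

(* For n > 0, sigma t - t is a multiple of 2 ^ n 2 pi, hence of 2 pi. *)
Lemma dilate_F_involutive n t : 0 < n -> ~ Z t -> F t -> E (2 ^ (- n) * t) ->
  sigma (sigma t) = t.
Proof.
move=> n0 Zt Ft Et; have [e [k [ek Ee se]]] := interpolation_map_preimage Zt Ft.
have [Es [j sj]] := dilate_F_into (lt0r_neq0 n0) Zt Ft Et.
suff <- : e = sigma t by [].
have Ze : ~ Z e by rewrite ek; exact: notin_translate.
have i : sigma t = e + 2 * (2 ^ n * j - k)%:~R * pi.
  rewrite sj ek intrB intrM; case: n n0 {Et sj} => // n _.
  by rewrite -!exprnP rmorphXn/=; ring.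
by rewrite i in Es *; rewrite (translate_uniq EZ Ze Ee Es).
Qed.

Lemma interpolation_involutive_E s : ~ Z s -> E s -> sigma (sigma s) = s.
Proof.
move=> Zs Es; have [Ft [k tk]] := interpolation_map_E Zs Es.
set t := sigma s in Ft tk *; have Zt : ~ Z t by exact: interpolation_map_notin.
have [[n Et] _ _ _] := EZ Zt.
have [n0|n0|n0] := ltgtP n 0; last first.
- rewrite n0 oppr0 expr0z mul1r tk in Et.
  have ts : t = s by rewrite tk; exact: translate_uniq EZ Zs Es Et.
  by rewrite ts -/t ts.
(* For [n > 0], [sigma (sigma t) = t = sigma s], and injectivity removes the outer sigma. *)
- apply: interpolation_map_inj => //.
    by apply: interpolation_map_notin; exact: interpolation_map_notin.
  exact: dilate_F_involutive n0 Zt Ft Et.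
have [Eu _] := dilate_F_into (ltr0_neq0 n0) Zt Ft Et.
have [Fv _] := interpolation_map_spec Zt Et.
set u := sigma t in Eu Fv *; have Zu : ~ Z u by exact: interpolation_map_notin.
have Zv : ~ Z (2 ^ (- n) * u) by exact: notin_dil.
have v2 : sigma (sigma (2 ^ (- n) * u)) = 2 ^ (- n) * u.
  apply: (@dilate_F_involutive (- n)) => //; first by rewrite oppr_gt0.
  by rewrite opprK exp2zVK.
rewrite interpolation_map_dil// interpolation_map_dil in v2; last first.
  exact: interpolation_map_notin.
(* From [sigma (sigma u) = u = sigma t] injectivity gives [sigma u = t = sigma s], and once more
   [u = s]. *)
have u2 : sigma (sigma u) = u by rewrite -[LHS](exp2zVK n) v2 exp2zVK.
have Zsu : ~ Z (sigma u) by exact: interpolation_map_notin.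
have t2 : sigma u = t by apply: interpolation_map_inj => //; rewrite u2.
by apply: interpolation_map_inj => //; rewrite -/u t2.
Qed.

Lemma interpolation_involutive s : ~ Z s -> sigma (sigma s) = s.
Proof.
move=> Zs; have [[n En] _ _ _] := EZ Zs.
have Zn : ~ Z (2 ^ (- n) * s) by exact: notin_dil.
have := interpolation_involutive_E Zn En.
rewrite interpolation_map_dil// interpolation_map_dil; last first.
  exact: interpolation_map_notin.
by move=> /(congr1 (fun x => 2 ^ n * x)); rewrite !exp2zVK.
Qed.

End into_union.

(** sigma maps [E] into [F], and every point of [F] off [Z] comes from [E]; an involution therefore
    sends it back to [E]. *)
Lemma involutive_into : (forall s, ~ Z s -> sigma (sigma s) = s) ->
  forall s, ~ Z s -> (E `|` F) s -> (E `|` F) (sigma s).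
Proof.
move=> s2 s Zs [Es|Fs]; first by right; have [] := interpolation_map_E Zs Es.
left; have [e [k [ek Ee se]]] := interpolation_map_preimage Zs Fs.
by rewrite -se s2// ek; exact: notin_translate.
Qed.

End interpolation.

Lemma partitions_offS (R : realType) (E Z Z' : set R) : Z `<=` Z' ->
  partitions_off E Z -> partitions_off E Z'.
Proof. by move=> ZZ' EZ s Zs; apply: EZ => /ZZ'. Qed.

Theorem theorem1 (R : realType) (E F : set R)
    (hE : wavelet_set E) (hF : wavelet_set F) :
  interpolation_pair E F <->
  ae_subset (interpolation_map E F @` (E `|` F)) (E `|` F).
Proof.
have [ZE nE pE] := wavelet_set_partitions hE.
have [ZF nF pF] := wavelet_set_partitions hF.
split=> [pair|sub].
- pose Z0 := (ZE `|` ZF) `|` ~` [set s | interpolation_map E F (interpolation_map E F s) = s].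
  have EZ : partitions_off E (hull Z0).
    by apply: partitions_offS pE => s ?; apply: sub_hull; left; left.
  have FZ : partitions_off F (hull Z0).
    by apply: partitions_offS pF => s ?; apply: sub_hull; left; right.
  have Zd := @hull_dil R Z0; have Zt := @hull_translate R Z0.
  apply: negligibleS (null_hull (negligibleU (negligibleU nE nF) pair)).
  move=> _ [[s EFs <-] nEF]; apply: contrapT => Zs; apply: nEF.
  (* The set to be shown null consists of images [sigma s], so what is known is that the image
     avoids the hull; this is carried over to [s]. *)
  have {}Zs : ~ hull Z0 s by move=> /(interpolation_map_in E F Zd Zt).
  apply: (involutive_into Zd Zt EZ FZ) => // u Zu; apply: contrapT => h.
  by apply: Zu; apply: sub_hull; right.
- pose Z0 := (ZE `|` ZF) `|` ((interpolation_map E F @` (E `|` F)) `\` (E `|` F)).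
  have EZ : partitions_off E (hull Z0).
    by apply: partitions_offS pE => s ?; apply: sub_hull; left; left.
  have FZ : partitions_off F (hull Z0).
    by apply: partitions_offS pF => s ?; apply: sub_hull; left; right.
  have Zd := @hull_dil R Z0; have Zt := @hull_translate R Z0.
  apply: negligibleS (null_hull (negligibleU (negligibleU nE nF) sub)).
  move=> s /= h; apply: contrapT => Zs; apply: h.
  apply: (interpolation_involutive Zd Zt EZ FZ) => // u Zu EFu; apply: contrapT => nEF.
  (* The bad set again consists of images: [sigma u] stays outside the hull, so it cannot be one of
     the images that leave the union. *)
  apply: (interpolation_map_notin Zd Zt EZ FZ Zu); apply: sub_hull; right.
  by split => //; exists u.
Qed.
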